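(* Let $z\in\mathcal{P}(\mathcal{X})$. If $Y^N(0)$ converges weakly (in distribution) to the deterministic element $z$ as $N\to\infty$, then the sequence of processes $(Y^N(t))_{t\ge 0}$ converges in distribution, for the Skorohod topology on the space of trajectories with values in $\mathcal{P}(\mathcal{X})$, to the solution $(y(t))_{t\ge0}$ of the ordinary differential equation $$y'(t)=V(y(t)),\qquad y(0)=z,$$ where, for $y\in\mathcal{P}(\mathcal{X})$, the vector field $V(y)=(V_n(y),\,n\in\mathcal{X})$ is defined by $$V_n(y)=\sum_{k=1}^{K}(\lambda_k+\gamma_k\langle\mathbb{I}_k,y\rangle)\left(y_{n-f_k}\mathbf{1}_{\{n_k\ge1\}}-y_n\mathbf{1}_{\{n+f_k\in\mathcal{X}\}}\right)+\sum_{k=1}^{K}(\gamma_k+\mu_k)\left((n_k+1)y_{n+f_k}\mathbf{1}_{\{n+f_k\in\mathcal{X}\}}-n_ky_n\right).$$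
   Context: Fix integers $K\ge1$, $C\ge1$, positive integers $A_1,\dots,A_K$ and rates $\lambda_k>0$, $\gamma_k>0$, $\mu_k\ge0$ for $1\le k\le K$. Let $f_k$ be the $k$th unit vector of $\mathbb{R}^K$, let $$\mathcal{X}=\{n=(n_k)\in\mathbb{N}^K: A_1n_1+\cdots+A_Kn_K\le C\}\quad(\mathbb{N}=\{0,1,2,\dots\}),$$ and let $\mathcal{P}(\mathcal{X})$ be the set of probability distributions $y=(y_n)_{n\in\mathcal{X}}$ on the finite set $\mathcal{X}$. Write $\langle\mathbb{I}_k,y\rangle=\sum_{m\in\mathcal{X}}m_ky_m$. Terms multiplied by a zero indicator are taken to be $0$. The network has $N\ge2$ identical nodes of capacity $C$. External class $k$ customers arrive at each node at rate $\lambda_k$; each class $k$ customer leaves the network at rate $\mu_k$, and moves at rate $\gamma_k$ to a node chosen uniformly among the $N-1$ other nodes; a class $k$ customer occupies $A_k$ units of capacity at the node where it is, and a customer arriving at a node without enough free capacity is rejected (lost). The state of node $i$ is the vector $X_i^N(t)\in\mathcal{X}$ of the numbers of customers of each class at node $i$, and the empirical distribution is $Y^N(t)=(Y^N_n(t))_{n\in\mathcal{X}}$ with $Y_n^N(t)=\frac1N\sum_{i=1}^N\mathbf{1}_{\{X_i^N(t)=n\}}$. Equivalently, with $e_n$ the $n$th unit vector of $\mathbb{R}^{\mathcal{X}}$, $(Y^N(t))$ is the Markov jump process on $\{y\in\mathcal{P}(\mathcal{X}):Ny_n\in\mathbb{N}\ \forall n\}$ whose transitions from $y$ are, for $n,m\in\mathcal{X}$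 and $1\le k\le K$: (i) $y\to y+\frac1N(e_{n+f_k}-e_n)$ at rate $\lambda_kNy_n\mathbf{1}_{\{n+f_k\in\mathcal{X}\}}$; (ii) $y\to y+\frac1N(e_{n-f_k}-e_n)$ at rate $\mu_kn_kNy_n$; (iii) $y\to y+\frac1N(e_{n-f_k}-e_n)+\frac1N(e_{m+f_k}-e_m)\mathbf{1}_{\{m+f_k\in\mathcal{X}\}}$ at rate $\frac{\gamma_kN}{N-1}n_ky_n(Ny_m-\mathbf{1}_{\{m=n\}})$ (rates of transitions leading to the same state are added). *)

(* Defs.v *)
From HB Require Import structures.
From mathcomp Require Import all_boot all_order all_algebra.
From mathcomp Require Import all_classical all_reals all_analysis.

Set Implicit Arguments.
Unset Strict Implicit.
Unset Printing Implicit Defensive.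

Import Order.TTheory GRing.Theory Num.Theory.
Import numFieldTopology.Exports numFieldNormedType.Exports.

Local Open Scope classical_set_scope.
Local Open Scope ring_scope.

(* Only the values of a path on [0, +oo[ are meaningful: nothing below looks
   at negative times, and two paths that agree on [0, +oo[ are topologically
   indistinguishable. *)
Record cadlag (R : realType) (E : metricType R) := Cadlag {
  path_of :> R -> E;
  cadlag_right : forall t, 0 <= t -> path_of s @[s --> t^'+] --> path_of t;
  cadlag_left : forall t, 0 < t -> exists l : E, path_of s @[s --> t^'-] --> l }.

HB.instance Definition _ (R : realType) (E : metricType R) :=
  gen_eqMixin (cadlag E).
HB.instance Definition _ (R : realType) (E : metricType R) :=
  gen_choiceMixin (cadlag E).

Definition time_change (R : realType) (l : R -> R) : Prop :=
  set_bij `[0, +oo[ `[0, +oo[ l /\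
  {in `[0, +oo[ &, {homo l : s t / s < t}}.

(* The paths [x'] such that, for some time change [l],
     sup_(t >= 0) |l t - t| < e  and  sup_(0 <= t <= M) dist (x t, x' (l t)) < e.
   For M, e > 0 these sets form a neighbourhood basis of [x] for the Skorohod
   J1 topology on D([0, +oo[, E): x_i tends to x in J1 iff there are time
   changes l_i such that l_i t - t tends to 0 uniformly in t >= 0 and
   dist (x t, x_i (l_i t)) tends to 0 uniformly on every [0, M]
   (Jacod-Shiryaev, VI.1.14; Ethier-Kurtz, 3.5.3). *)
Definition skorohod_ball (R : realType) (E : metricType R) (x : cadlag E)
    (M e : R) : set (cadlag E) :=
  [set x' | exists l, time_change l /\ exists2 e', e' < e &
     (forall t, 0 <= t -> `|l t - t| <= e') /\
     (forall t, 0 <= t <= M -> mdist (x t) (x' (l t)) <= e')].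

Definition skorohod_open (R : realType) (E : metricType R)
    (U : set (cadlag E)) : Prop :=
  forall x, U x -> exists M e, [/\ 0 < M, 0 < e & skorohod_ball x M e `<=` U].

Section skorohod_topology.
Context (R : realType) (E : metricType R).

Lemma skorohod_ball_sub (x : cadlag E) M1 M2 e1 e2 : M1 <= M2 -> e2 <= e1 ->
  skorohod_ball x M2 e2 `<=` skorohod_ball x M1 e1.
Proof.
move=> M12 e21 x' [l [tl [e' e'e [H1 H2]]]]; exists l; split => //.
exists e'; first exact: lt_le_trans e21.
split=> // t /andP[t0 tM]; apply: H2; rewrite t0.
exact: le_trans M12.
Qed.

Let opT : skorohod_open (@setT (cadlag E)).
Proof. by move=> x _; exists 1, 1; split. Qed.

Let opI : setI_closed (@skorohod_open R E).
Proof.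
move=> U W oU oW x [/oU[M [e [M0 e0 sU]]] /oW[M' [e' [M'0 e'0 sW]]]].
exists (Num.max M M'), (Num.min e e'); split.
- by rewrite lt_max M0.
- by rewrite lt_min e0 e'0.
- move=> x' xx'; split; [apply: sU|apply: sW];
    by apply: skorohod_ball_sub xx'; rewrite ?le_max ?ge_min lexx ?orbT.
Qed.

Let op_bigU (I : Type) (f : I -> set (cadlag E)) :
  (forall i, skorohod_open (f i)) -> skorohod_open (\bigcup_i f i).
Proof.
move=> of_ x [i _ /of_[M [e [M0 e0 sf]]]]; exists M, e; split => //.
by move=> x' /sf fx'; exists i.
Qed.

HB.instance Definition _ :=
  isOpenTopological.Build (cadlag E) opT opI op_bigU.

Lemma skorohod_ball_center (x : cadlag E) M e :
  0 < e -> skorohod_ball x M e x.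
Proof.
move=> e0; exists id; split.
  by split; [split=> // t t0; exists t|move=> s t _ _].
exists 0 => //; split=> t _; first by rewrite subrr normr0.
by rewrite mdistxx.
Qed.

Lemma time_change_comp (l m : R -> R) :
  time_change l -> time_change m -> time_change (m \o l).
Proof.
move=> [bl il] [bm im]; split; first exact: set_bij_comp bl bm.
have lin t : t \in `[0, +oo[ -> l t \in `[0, +oo[.
  by move=> t0; have [+ _ _] := bl; apply; rewrite inE in t0 *.
by move=> s t s0 t0 st; apply: im; [exact: lin|exact: lin|exact: il].
Qed.

Lemma skorohod_ball_open (x : cadlag E) M e :
  0 < M -> open (skorohod_ball x M e).
Proof.
move=> M0; change (skorohod_open (skorohod_ball x M e)).
move=> y [l [tl [e' e'e [H1 H2]]]].
have l0 t : 0 <= t -> 0 <= l t.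
  move=> t0; have [[+ _ _] _] := tl.
  by move=> /(_ t); rewrite /= !in_itv/= !andbT; apply.
have e'0 : 0 <= e' by apply: le_trans (H1 0 (lexx _)).
exists (M + e'), (e - e'); split; [exact: ltr_wpDr|by rewrite subr_gt0|].
move=> y' [m [tm [e'' e''e [G1 G2]]]]; exists (m \o l); split.
  exact: time_change_comp.
exists (e' + e''); first by rewrite -ltrBrDl.
split=> t.
- move=> t0 /=; rewrite -(subrK (l t) (m (l t))) -addrA addrC.
  apply: le_trans (ler_normD _ _) _; apply: lerD; first exact: H1.
  exact/G1/l0.
- move=> /andP[t0 tM]; apply: le_trans (metric_triangle _ (y (l t)) _) _.
  apply: lerD; first by apply: H2; rewrite t0.
  apply: G2; rewrite l0//=.
  have /ler_normlP[_ lt] := H1 _ t0.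
  by rewrite lerBlDl in lt; apply: le_trans lt _; rewrite lerD2r.
Qed.

Lemma skorohod_nbhsP (x : cadlag E) (U : set (cadlag E)) :
  nbhs x U <-> exists M e, [/\ 0 < M, 0 < e & skorohod_ball x M e `<=` U].
Proof.
split.
  rewrite nbhsE => -[W [oW Wx] sWU]; change (skorohod_open W) in oW.
  have [M [e [M0 e0 sW]]] := oW x Wx.
  by exists M, e; split=> //; exact: subset_trans sWU.
move=> [M [e [M0 e0 sU]]]; rewrite nbhsE; exists (skorohod_ball x M e) => //.
by split; [exact: skorohod_ball_open|exact: skorohod_ball_center].
Qed.

End skorohod_topology.

(* Convergence in distribution of the random elements [X i] to the
   deterministic element [x].  When E = cadlag E', the Borel sigma-algebra is
   generated by the coordinates [X i ^~ t], so that [f \o X i] is measurable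
   as soon as these are. *)
Definition cvg_in_distribution (R : realType) (E : topologicalType)
    (d : nat -> measure_display) (T : forall i, measurableType (d i))
    (P : forall i, probability (T i) R) (X : forall i, T i -> E) (x : E) : Prop :=
  forall f : E -> R, continuous f -> (exists M, forall y, `|f y| <= M) ->
    ('E_(P i)[f \o X i])%E @[i --> \oo] --> (f x)%:E.

(* The derivative of [f : [0, +oo[ -> R] at [t >= 0], one-sided if t = 0. *)
Definition is_derive_nonneg (R : realType) (f : R -> R) (t df : R) : Prop :=
  (f s - f t) / (s - t) @[s --> within [set s | 0 <= s] t^'] --> df.

Definition natural_filtration (R : realType) (E : metricType R) (T : Type)
    (Y : T -> cadlag E) (t : R) : set (set T) :=
  <<s [set B | exists s x, [/\ 0 <= s, s <= t & B = [set w | Y w s = x]] ] >>.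

(* [Y] is a Markov jump process on the finite state space [S] jumping from [x]
   to [x'] != [x] at rate [q x x'] (the values [q x x] play no role). Its
   transition function [p] is the solution of the backward equation
   p_t' = Q p_t, p_0 = 1, i.e. p_t = exp(t Q). *)
Record markov_jump_process (R : realType) (E : metricType R) (S : set E)
    (q : E -> E -> R) (d : measure_display) (T : measurableType d)
    (P : probability T R) (Y : T -> cadlag E) : Prop := {
  jump_state : forall w t, 0 <= t -> S (Y w t);
  jump_measurable : forall t x, 0 <= t -> measurable [set w | Y w t = x];
  jump_markov : exists p : R -> E -> E -> R,
    [/\ forall x x', S x -> S x' -> p 0 x x' = (x == x')%:R,
        forall t x x', 0 <= t -> S x -> S x' ->
          is_derive_nonneg (fun s => p s x x') t
            (\sum_(u \in S) q x u * (p t u x' - p t x x')) &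
        forall s t x x' B, 0 <= s <= t -> S x -> S x' ->
          natural_filtration Y s B ->
          (P (B `&` [set w | Y w s = x] `&` [set w | Y w t = x']) =
           P (B `&` [set w | Y w s = x]) * (p (t - s) x x')%:E)%E] }.

(* The set of states of a node. As A_k >= 1 in all uses, the bound n_k <= C is
   a consequence of the capacity constraint. *)
Definition config (K C : nat) (A : 'I_K -> nat) : Type :=
  {n : {ffun 'I_K -> 'I_C.+1} | (\sum_k A k * n k <= C)%N}.

HB.instance Definition _ K C A := Finite.on (@config K C A).

Section simplex.
Context (R : realType) (X : finType).

(* Probability distributions on X, with the distance induced by R^X. *)
Definition simplex : Type :=
  {y : {ffun X -> R} | [forall n, 0 <= y n] && (\sum_n y n == 1)}.

HB.instance Definition _ := Choice.on simplex.

Definition mass (y : simplex) : {ffun X -> R} := val y.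

Definition simplex_dist (y y' : simplex) : R :=
  \sum_n `|mass y n - mass y' n|.

Let distxx y : simplex_dist y y = 0.
Proof. by apply: big1 => n _; rewrite subrr normr0. Qed.

Let dist_pos y y' : simplex_dist y y' = 0 -> y = y'.
Proof.
move=> /eqP; rewrite psumr_eq0// => /allP H; apply: val_inj; apply/ffunP => n.
by have := H n (mem_index_enum _); rewrite normr_eq0 subr_eq0 => /eqP.
Qed.

Let dist_sym y y' : simplex_dist y y' = simplex_dist y' y.
Proof. by apply: eq_bigr => n _; rewrite distrC. Qed.

Let dist_triangle y x z :
  simplex_dist x z <= simplex_dist x y + simplex_dist y z.
Proof. by rewrite -big_split; apply: ler_sum => n _; exact: ler_distD. Qed.

HB.instance Definition _ :=
  isMetric.Build R simplex distxx dist_pos dist_sym dist_triangle.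

End simplex.

Coercion mass : simplex >-> finfun_of.

Section network.
Context (R : realType) (K C : nat) (A : 'I_K -> nat).
Context (lambda gamma mu : 'I_K -> R).

Local Notation X := (config C A).

Definition pop (n : X) (k : 'I_K) : nat := val n k.

(* [incr n k] is n + f_k and [decr n k] is n - f_k, or [None] outside X: when
   A k >= 1, [incr n k != None] is the indicator of n + f_k \in X, and
   [decr n k != None] that of n_k >= 1. *)
Definition incr (n : X) (k : 'I_K) : option X :=
  [pick m | [forall j, pop m j == (pop n j + (j == k))%N]].

Definition decr (n : X) (k : 'I_K) : option X :=
  [pick m | [forall j, pop n j == (pop m j + (j == k))%N]].

Definition mean_pop (k : 'I_K) (y : simplex R X) : R :=
  \sum_m (pop m k)%:R * y m.

Definition V (y : simplex R X) (n : X) : R :=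
  \sum_k (lambda k + gamma k * mean_pop k y) *
     (oapp y 0 (decr n k) - y n * (incr n k != None)%:R)
  + \sum_k (gamma k + mu k) *
     ((pop n k).+1%:R * oapp y 0 (incr n k) - (pop n k)%:R * y n).

Definition ode_solution (z : simplex R X) (y : cadlag (simplex R X)) : Prop :=
  y 0 = z /\
  forall t n, 0 <= t -> is_derive_nonneg (fun s => mass (y s) n) t (V (y t) n).

Definition unitv (n : X) : {ffun X -> R} := [ffun m => (m == n)%:R].

Section jumps.
Variable N : nat.

Definition empirical_states : set (simplex R X) :=
  [set y | forall n, exists j : nat, N%:R * y n = j%:R].

(* Displacements of N times the empirical distribution; those which involve
   n - f_k with n_k = 0 have rate 0. *)
Definition arrival_jump (n : X) (k : 'I_K) : {ffun X -> R} :=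
  oapp unitv 0 (incr n k) - unitv n.

Definition departure_jump (n : X) (k : 'I_K) : {ffun X -> R} :=
  oapp unitv 0 (decr n k) - unitv n.

Definition transfer_jump (n m : X) (k : 'I_K) : {ffun X -> R} :=
  departure_jump n k + (if incr m k != None then arrival_jump m k else 0).

Definition goes (y y' : simplex R X) (v : {ffun X -> R}) : bool :=
  mass y' == mass y + N%:R^-1 *: v.

Definition rate (y y' : simplex R X) : R :=
  \sum_n \sum_k (lambda k * N%:R * y n * (incr n k != None)%:R) *
    (goes y y' (arrival_jump n k))%:R
  + \sum_n \sum_k (mu k * (pop n k)%:R * N%:R * y n) *
    (goes y y' (departure_jump n k))%:R
  + \sum_n \sum_m \sum_k
    (gamma k * N%:R / (N%:R - 1) * (pop n k)%:R * y n *
       (N%:R * y m - (m == n)%:R)) *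
    (goes y y' (transfer_jump n m k))%:R.

Definition empirical_process (d : measure_display) (T : measurableType d)
    (P : probability T R) (Y : T -> cadlag (simplex R X)) : Prop :=
  markov_jump_process empirical_states rate P Y.

End jumps.
End network.

(* Main.v *)
Require Import Defs.
From mathcomp Require Import all_boot all_order all_algebra.
From mathcomp Require Import all_classical all_reals all_analysis.
From mathcomp Require Import finmap ring lra.

(** Let [y] solve the differential equation from [z], and let [Q] be the
generator of the empirical process of [N] nodes. Its jumps have size O(1/N) and
total rate O(N), and its drift differs from [V] by O(1/N). Expanding the square
of the Euclidean norm therefore gives, for a state [x] ([generator_sqdist]),
[[
  Q |. - y(t)|^2 (x) <= 2 <x - y(t), V(x)> + kappa / N,
]]
and since [V] is Lipschitz ([one_sided_lipschitz]), adding the derivative in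
time leaves at most [(c - 1) |x - y(t)|^2 + kappa / N] for some [c >= 1].
Hence
[[
  phi(t, x) = exp(- c t) (|x - y(t)|^2 + kappa / N)
]]
satisfies [d phi / dt + Q phi <= 0], and [phi(t, Y^N(t))] is a nonnegative
supermartingale. By the maximal inequality, the probability that it ever
exceeds [a] is at most [(E |Y^N(0) - z|^2 + kappa / N) / a]
([empirical_maximal_inequality]). The expectation tends to 0, because the square
distance to [z] is a continuous bounded function of the initial state that
vanishes at [z]. So, with a probability that tends to 1, [Y^N] is uniformly
close to [y] on bounded time intervals, hence close to it in the Skorohod
topology, with the identity as time change ([mean_field_convergence]). The
exponential weight plays the part of Gronwall's lemma, and the supermartingale
that of a decomposition of [Y^N] into a drift and a martingale.

The Markov property is given through a transition function that solves the
backward equation. That [phi(t, Y^N(t))] is a supermartingale is a comparison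
between a solution and a supersolution of this equation, which follows from
[minimum_principle]. The state space being finite, expectations are finite
sums; the maximal inequality is proved by induction on finite time grids and
extended to all times by right-continuity
([supermartingale_maximal_inequality]).

The solution [y] is built as a limit of Euler schemes ([ode_exists]), which stay
in the simplex because mass leaves a state only in proportion to the mass
present ([V_ge]). Two solutions agree since their discounted square distance
does not increase, which is the minimum principle on a one-point space
([ode_unique]).

Convergence in distribution is tested with continuous functions of the whole
path. Their expectations are compared with those of simple functions by the
monotonicity of the integral, which does not depend on measurability
([le_expectation]). *)

Set Implicit Arguments.
Unset Strict Implicit.
Unset Printing Implicit Defensive.

Import Order.TTheory GRing.Theory Num.Theory.
Import numFieldTopology.Exports numFieldNormedType.Exports.

Local Open Scope classical_set_scope.
Local Open Scope ring_scope.

(** * Derivatives within a set and a minimum principle *)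

Section derivative_within.
Context {R : realType}.
Implicit Types (D : set R) (f g : R -> R).

(** Caratheodory's form of the derivative of [f] at [t] relative to [D]: at an
end point of an interval it is one-sided, and the rules for sums and products
reduce to those for limits. *)
Definition deriv_within D f (t df : R) := exists2 q : R -> R,
  q s @[s --> within D (nbhs t)] --> df &
  forall s, D s -> f s = f t + q s * (s - t).

Let cvg_subx t : s - t @[s --> t] --> (0 : R).
Proof.
have : s - t @[s --> t] --> t - t.
  by apply: cvgB; [exact: cvg_id|exact: cvg_cst].
by rewrite subrr.
Qed.

Lemma deriv_within_cvg D f t df : deriv_within D f t df ->
  f s @[s --> within D (nbhs t)] --> f t.
Proof.
move=> [q qdf fE].
have st0 : s - t @[s --> within D (nbhs t)] --> (0 : R).
  apply: cvg_within_filter.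
  exact: cvg_subx.
have : f t + q s * (s - t) @[s --> within D (nbhs t)] --> f t + df * 0.
  by apply: cvgD; [exact: cvg_cst|exact: cvgM].
rewrite mulr0 addr0; apply: cvg_trans.
apply: near_eq_cvg; rewrite near_withinE; apply: nearW => s Ds.
by rewrite /= -(fE s Ds).
Qed.

Lemma deriv_within_cst D (c t : R) : deriv_within D (fun=> c) t 0.
Proof.
by exists (fun=> 0) => [|s _]; [exact: cvg_cst|rewrite mul0r addr0].
Qed.

Lemma deriv_within_id D (t : R) : deriv_within D id t 1.
Proof.
by exists (fun=> 1) => [|s _]; [exact: cvg_cst|rewrite mul1r addrC subrK].
Qed.

Lemma deriv_withinD D f g t df dg : deriv_within D f t df ->
  deriv_within D g t dg -> deriv_within D (fun s => f s + g s) t (df + dg).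
Proof.
move=> [p pdf fE] [q qdg gE]; exists (fun s => p s + q s); first exact: cvgD.
by move=> s Ds; rewrite (fE s Ds) (gE s Ds); ring.
Qed.

Lemma deriv_withinM D f g t df dg : deriv_within D f t df ->
  deriv_within D g t dg ->
  deriv_within D (fun s => f s * g s) t (df * g t + f t * dg).
Proof.
move=> fdf gdg; have gc := deriv_within_cvg gdg.
move: fdf gdg => [p pdf fE] [q qdg gE]; exists (fun s => p s * g s + f t * q s).
  by apply: cvgD; apply: cvgM => //; exact: cvg_cst.
by move=> s Ds; rewrite (fE s Ds) (gE s Ds); ring.
Qed.

Lemma deriv_withinZ D (c : R) f t df : deriv_within D f t df ->
  deriv_within D (fun s => c * f s) t (c * df).
Proof.
by move=> /(deriv_withinM (deriv_within_cst D c t)); rewrite mul0r add0r.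
Qed.

Lemma deriv_withinB D f g t df dg : deriv_within D f t df ->
  deriv_within D g t dg -> deriv_within D (fun s => f s - g s) t (df - dg).
Proof.
move=> fd /(deriv_withinZ (-1)) /(deriv_withinD fd); rewrite mulN1r.
by under eq_fun do rewrite mulN1r.
Qed.

Lemma deriv_within_sum D (I : eqType) (r : seq I) (f : I -> R -> R) t df :
  (forall i, i \in r -> deriv_within D (f i) t (df i)) ->
  deriv_within D (fun s => \sum_(i <- r) f i s) t (\sum_(i <- r) df i).
Proof.
elim: r => [_|i r IH fd].
  by under eq_fun do rewrite big_nil; rewrite big_nil; exact: deriv_within_cst.
under eq_fun do rewrite big_cons; rewrite big_cons; apply: deriv_withinD.
  by apply: fd; exact: mem_head.
by apply: IH => j jr; apply: fd; rewrite inE jr orbT.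
Qed.

Lemma deriv_withinS D D' f t df : D' `<=` D ->
  deriv_within D f t df -> deriv_within D' f t df.
Proof.
move=> D'D [q qdf fE]; exists q; last by move=> s /D'D /fE.
move=> U /qdf; rewrite /within /nbhs /=.
by apply: filterS => s + D's; apply; exact: D'D.
Qed.

(** Turns a derivative in time into a derivative in the time remaining until
[b], in which the backward equation is written. *)
Lemma deriv_within_reflect D f b t df : deriv_within D f (b - t) df ->
  deriv_within [set s | D (b - s)] (fun s => f (b - s)) t (- df).
Proof.
move=> [q qdf fE]; exists (fun s => - q (b - s)); last first.
  by move=> s Ds; rewrite (fE (b - s) Ds); ring.
apply: cvgN.
have bs : b - s @[s --> within [set s | D (b - s)] (nbhs t)]
    --> within D (nbhs (b - t)).
  move=> A; rewrite /within /nbhs /= => wA.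
  have : b - s @[s --> t] --> b - t.
    by apply: cvgB; [exact: cvg_cst|exact: cvg_id].
  by move=> /(_ _ wA); rewrite /nbhs /=.
exact: (cvg_comp _ _ bs qdf).
Qed.

Lemma deriv_within_quotient D f t df :
  (f s - f t) / (s - t) @[s --> within D t^'] --> df -> deriv_within D f t df.
Proof.
move=> fdf; exists (fun s => if s == t then df else (f s - f t) / (s - t)).
  move=> U /= Udf.
  have H : \forall s \near t, s != t -> D s -> U ((f s - f t) / (s - t)).
    exact: fdf _ Udf.
  suff : \forall s \near t, D s -> U (if s == t then df
    else (f s - f t) / (s - t)) by [].
  apply: filterS H => s sU Ds.
  by case: eqP => [_|/eqP st]; [exact: nbhs_singleton Udf|exact: sU].
move=> s _; case: eqP => [->|/eqP st]; first by rewrite subrr mulr0 addr0.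
by rewrite divfK ?subr_eq0 // addrC subrK.
Qed.

Lemma deriv_within_expR D (c t : R) :
  deriv_within D (fun s => expR (c * s)) t (c * expR (c * t)).
Proof.
apply: (@deriv_withinS setT) => //.
have [dE E] : is_derive t 1 (fun s : R => expR (c * s)) (c * expR (c * t)).
  by apply: is_derive_eq; rewrite /GRing.scale/= mulr1 mulrC.
apply: deriv_within_quotient; rewrite -E.
have st : s - t @[s --> within setT t^'] --> (0 : R)^'.
  move=> U U0; have H : \forall h \near (0 : R), h != 0 -> U h by exact: U0.
  suff : \forall s \near t, s != t -> setT s -> U (s - t) by [].
  have : \forall s \near t, s - t != 0 -> U (s - t) by exact: cvg_subx H.
  by apply: filterS => s sU st _; apply: sU; rewrite subr_eq0.
have := cvg_comp _ _ st dE; apply: cvg_trans; apply: near_eq_cvg.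
by apply: nearW => s /=; rewrite /GRing.scale/= mulr1 subrK mulrC.
Qed.

End derivative_within.

Lemma seq_argmin (R : realType) (I : eqType) (m : I -> R) (S : seq I) i :
  i \in S -> exists2 j, j \in S & forall k, k \in S -> m j <= m k.
Proof.
elim: S i => // i0 S IH i _.
case: S IH => [_|i1 S IH].
  by exists i0 => [|k]; rewrite ?inE // => /eqP ->.
have [j jS jmin] := IH i1 (mem_head _ _).
have [ij|ji] := leP (m i0) (m j).
  exists i0 => [|k]; first exact: mem_head.
  by rewrite inE => /orP[/eqP -> //|/jmin]; exact: le_trans.
exists j => [|k]; first by rewrite inE jS orbT.
by rewrite inE => /orP[/eqP ->|/jmin //]; exact: ltW.
Qed.

(** A supersolution of [w' = Q w] that starts nonnegative stays nonnegative: at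
a minimum over time and space the spatial term is nonnegative, whereas the
derivative in time is nonpositive. A small multiple of [1 + r] added to [w]
raises its derivative but not the spatial term, and makes the two
incompatible. *)
Lemma minimum_principle (R : realType) (I : eqType) (S : seq I)
    (q : I -> I -> R) (b : R) (w dw : I -> R -> R) :
  0 <= b ->
  (forall i j, i \in S -> j \in S -> 0 <= q i j) ->
  (forall i r, i \in S -> 0 <= r <= b ->
     deriv_within `[0, b] (w i) r (dw i r)) ->
  (forall i r, i \in S -> 0 <= r <= b ->
     \sum_(j <- S) q i j * (w j r - w i r) <= dw i r) ->
  (forall i, i \in S -> 0 <= w i 0) ->
  forall i, i \in S -> 0 <= w i b.
Proof.
move=> b0 q0 wd wdw w0 i iS; rewrite leNgt; apply/negP => wi.
(* With this [e] the corrected function [v] is still below its initial values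
   at the point where [w] is negative. *)
pose e := - w i b / (2 * (1 + b)).
have b1 : 0 < 1 + b by rewrite ltr_wpDr.
have e0 : 0 < e by rewrite divr_gt0 ?oppr_gt0 // mulr_gt0.
pose v j r := w j r + e * (1 + r).
have vd j r : j \in S -> 0 <= r <= b ->
    deriv_within `[0, b] (v j) r (dw j r + e).
  move=> jS rb.
  have -> : dw j r + e = dw j r + e * (0 + 1) by rewrite add0r mulr1.
  apply: deriv_withinD; first exact: wd.
  by apply: deriv_withinZ; apply: deriv_withinD;
    [exact: deriv_within_cst|exact: deriv_within_id].
have vmin j : j \in S -> exists2 r, 0 <= r <= b &
    forall s, 0 <= s <= b -> v j r <= v j s.
  move=> jS; have vc : {within `[0, b], continuous (v j)}.
    apply/subspace_continuousP => r; rewrite /= in_itv/= => rb.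
    exact: deriv_within_cvg (vd _ _ jS rb).
  have [r rb rmin] := EVT_min b0 vc.
  by exists r => [|s sb]; [rewrite in_itv in rb|apply: rmin; rewrite in_itv].
have [j [r [jS rb jmin]]] : exists j r, [/\ j \in S, 0 <= r <= b &
    forall k s, k \in S -> 0 <= s <= b -> v j r <= v k s].
  have /choice[r rP] : forall j, exists r, j \in S -> 0 <= r <= b /\
      forall s, 0 <= s <= b -> v j r <= v j s.
    move=> j; have [/vmin[r rb rmin]|jS] := boolP (j \in S); last by exists 0.
    by exists r.
  have [j jS jmin] := seq_argmin (fun j => v j (r j)) iS.
  exists j, (r j); have [rb _] := rP _ jS; split => // k s kS sb.
  exact: le_trans (jmin _ kS) ((rP _ kS).2 _ sb).
have vi : v i b < e.
  have : e * (1 + b) * 2 = - w i b by rewrite /e; field; rewrite gt_eqF.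
  by rewrite /v => E; move: wi e0; nra.
have r0 : 0 < r.
  case/andP: rb => r0 _; rewrite lt_neqAle r0 andbT; apply/eqP => r0E.
  have := jmin _ b iS; rewrite b0 lexx => /(_ isT); rewrite -r0E.
  apply/negP; rewrite -ltNge (lt_le_trans vi) // /v addr0 mulr1 lerDr.
  exact: w0.
have dv : 0 < dw j r + e.
  apply: ltr_wpDl => //; apply: le_trans (wdw _ _ jS rb).
  rewrite big_seq; apply: sumr_ge0 => k kS; rewrite mulr_ge0 ?q0 // subr_ge0.
  by have := jmin _ _ kS rb; rewrite /v lerD2r.
have [p pdv vE] := vd _ _ jS rb.
have : \forall s \near r, `[0, b]%classic s -> 0 < p s.
  exact: (cvgr_gt _ pdv).
move=> /nbhs_ballP[d /= d0 rd].
have [rb0 rb1] := andP rb.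
pose s := r - Num.min r (d / 2).
have m0 : 0 < Num.min r (d / 2) by rewrite lt_min r0 divr_gt0.
have sb : 0 <= s <= b.
  rewrite /s subr_ge0 ge_min lexx/= (le_trans _ rb1) //.
  by rewrite gerBl ltW.
have ps : 0 < p s.
  apply: rd; last by rewrite /= in_itv.
  rewrite /ball/= /s opprB addrC subrK gtr0_norm //.
  by rewrite gt_min; apply/orP; right; rewrite ltr_pdivrMr // ltr_pMr // ltr1n.
have := jmin _ _ jS sb; rewrite (vE s) /=; last by rewrite in_itv.
by rewrite lerDl /s addrAC subrr add0r mulrN oppr_ge0 leNgt mulr_gt0.
Qed.

(** * Supermartingales of finite Markov jump processes *)

Section finite_markov_process.
Context {R : realType} {E : metricType R} {S : set E} {q : E -> E -> R}.
Context {d : measure_display} {T : measurableType d} {P : probability T R}.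
Context {Y : T -> cadlag E}.
Hypothesis finS : finite_set S.
Hypothesis markovY : markov_jump_process S q P Y.
Hypothesis q_ge0 : forall x u, S x -> S u -> 0 <= q x u.
Implicit Types (B : set T) (t : R) (f : E -> R).

(** The expectation of [f (Y t)] on the event [B], as a finite sum over the
states. *)
Definition mean_on B t f : R :=
  \sum_(x <- fset_set S) f x * fine (P (B `&` [set w | Y w t = x])).

Let in_S x : x \in (fset_set S : seq E) -> S x.
Proof. by move=> xS; apply: set_mem; rewrite -in_fset_set. Qed.

Let state_measurable t x : 0 <= t -> measurable [set w | Y w t = x].
Proof. exact: (jump_measurable markovY). Qed.

Let fine_P_ge0 B : 0 <= fine (P B).
Proof. exact/fine_ge0/measure_ge0. Qed.

Let fine_PU B1 B2 : measurable B1 -> measurable B2 -> B1 `&` B2 = set0 ->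
  fine (P (B1 `|` B2)) = fine (P B1) + fine (P B2).
Proof.
by move=> m1 m2 B0; rewrite measureU // fineD //; exact: fin_num_measure.
Qed.

Lemma filtration_measurable t B :
  natural_filtration Y t B -> measurable B.
Proof.
apply: smallest_sub; first exact: sigma_algebra_measurable.
by move=> _ [s [x [s0 _ ->]]]; exact: state_measurable.
Qed.

Lemma filtration_nondecreasing s t : s <= t ->
  natural_filtration Y s `<=` natural_filtration Y t.
Proof.
move=> st; apply: sub_sigma_algebra2 => _ [r [x [r0 rs ->]]].
by exists r, x; split => //; exact: le_trans st.
Qed.

Lemma filtrationI t B1 B2 : natural_filtration Y t B1 ->
  natural_filtration Y t B2 -> natural_filtration Y t (B1 `&` B2).
Proof.
pose G := [set B | exists s x, [/\ 0 <= s, s <= t & B = [set w | Y w s = x]]].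
by move=> m1 m2; exact: (@measurableI _ (g_sigma_algebraType G)).
Qed.

Lemma filtration_state s t (A : set E) : 0 <= s <= t ->
  natural_filtration Y t [set w | A (Y w s)].
Proof.
move=> /andP[s0 st].
pose G := [set B | exists s x, [/\ 0 <= s, s <= t & B = [set w | Y w s = x]]].
have -> : [set w | A (Y w s)] =
    \bigcup_(x in S `&` A) [set w | Y w s = x].
  apply/seteqP; split => [w Aw|w [x [_ Ax] /= ->]] //.
  by exists (Y w s) => //; split => //; exact: jump_state markovY _ _ s0.
apply: (@fin_bigcup_measurable _ (g_sigma_algebraType G)).
  exact: finite_setIl.
by move=> x _; apply: sub_sigma_algebra; exists s, x.
Qed.

Lemma mean_on1 B t : measurable B -> 0 <= t ->
  \sum_(x <- fset_set S) fine (P (B `&` [set w | Y w t = x])) = fine (P B).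
Proof.
move=> mB t0.
have BE : B = \bigcup_(x in S) (B `&` [set w | Y w t = x]).
  apply/seteqP; split => [w Bw|w [x _ []//]].
  by exists (Y w t) => //; exact: jump_state markovY _ _ t0.
rewrite {2}BE measure_fin_bigcup //.
- rewrite fsbig_finite // sum_fine // => x _; apply: fin_num_measure.
  by apply: measurableI => //; exact: state_measurable.
- apply/trivIsetP => x y _ _ xy; apply/seteqP; split => // w.
  by move=> [[_ /= wx] [_ /= wy]]; move: xy; rewrite -wx -wy eqxx.
- by move=> x _; apply: measurableI => //; exact: state_measurable.
Qed.

Lemma mean_onU B1 B2 t f : measurable B1 -> measurable B2 ->
  B1 `&` B2 = set0 -> 0 <= t ->
  mean_on (B1 `|` B2) t f = mean_on B1 t f + mean_on B2 t f.
Proof.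
move=> m1 m2 B0 t0; rewrite -big_split/=; apply: eq_bigr => x _.
rewrite setIUl fine_PU ?mulrDr //.
- by apply: measurableI => //; exact: state_measurable.
- by apply: measurableI => //; exact: state_measurable.
- by rewrite setIACA B0 set0I.
Qed.

Lemma mean_on_ge B t f a : measurable B -> 0 <= t ->
  (forall w, B w -> a <= f (Y w t)) -> a * fine (P B) <= mean_on B t f.
Proof.
move=> mB t0 af; rewrite -(mean_on1 mB t0) mulr_sumr.
apply: ler_sum => x _.
have [->|/set0P[w [Bw /= <-]]] := eqVneq (B `&` [set w | Y w t = x]) set0.
  by rewrite measure0 !mulr0.
by rewrite ler_wpM2r // af.
Qed.

Section supermartingale.
Variables phi dphi : R -> E -> R.
Hypothesis phi_ge0 : forall t x, 0 <= t -> S x -> 0 <= phi t x.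
Hypothesis phi_deriv : forall t x, 0 <= t -> S x ->
  deriv_within [set s | 0 <= s] (phi ^~ x) t (dphi t x).
Hypothesis phi_generator : forall t x, 0 <= t -> S x ->
  dphi t x + \sum_(u <- fset_set S) q x u * (phi t u - phi t x) <= 0.

(** Both [r |-> phi (t - r) x] and [r |-> E_x (phi t (Y r))] start from
[phi t x]; the first is a supersolution and the second a solution of the
backward equation. *)
Lemma backward_comparison (p : R -> E -> E -> R) :
  (forall x x', S x -> S x' -> p 0 x x' = (x == x')%:R) ->
  (forall t x x', 0 <= t -> S x -> S x' ->
     is_derive_nonneg (fun s => p s x x') t
       (\sum_(u \in S) q x u * (p t u x' - p t x x'))) ->
  forall s t x, 0 <= s <= t -> S x ->
  \sum_(x' <- fset_set S) phi t x' * p (t - s) x x' <= phi s x.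
Proof.
move=> p0 pd s t x /andP[s0 st] Sx.
have t0 := le_trans s0 st.
pose u r x := \sum_(x' <- fset_set S) phi t x' * p r x x'.
pose qu r x := \sum_(y <- fset_set S) q x y * (u r y - u r x).
have ud r y : 0 <= r -> S y ->
    deriv_within [set s | 0 <= s] (u ^~ y) r (qu r y).
  move=> r0 Sy; have -> : qu r y = \sum_(x' <- fset_set S)
      phi t x' * \sum_(v \in S) q y v * (p r v x' - p r y x').
    under [RHS]eq_bigr do rewrite fsbig_finite // mulr_sumr.
    rewrite exchange_big; apply: eq_bigr => v _ /=.
    rewrite -sumrB mulr_sumr; apply: eq_bigr => x' _; ring.
  apply: deriv_within_sum => x' /in_S Sx'; apply: deriv_withinZ.
  by apply: deriv_within_quotient; exact: (pd _ _ _ r0 Sy Sx').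
pose w y r := phi (t - r) y - u r y.
have ts0 : 0 <= t - s by rewrite subr_ge0.
suff : forall y, y \in (fset_set S : seq E) -> 0 <= w y (t - s).
  have xS : x \in (fset_set S : seq E) by rewrite in_fset_set // mem_set.
  by move=> /(_ x xS); rewrite /w subKr subr_ge0.
apply: (@minimum_principle R E (fset_set S : seq E) q (t - s) w
    (fun y r => - dphi (t - r) y - qu r y)) => //.
- by move=> y v /in_S Sy /in_S Sv; exact: q_ge0.
- move=> y r /in_S Sy /andP[r0 rts].
  have tr0 : 0 <= t - r by rewrite subr_ge0 (le_trans rts) // gerBl.
  apply: deriv_withinB.
    apply: deriv_withinS (deriv_within_reflect (phi_deriv tr0 Sy)).
    move=> r' /=; rewrite in_itv/= => /andP[_ r'ts].
    by rewrite subr_ge0 (le_trans r'ts) // gerBl.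
  apply: deriv_withinS (ud _ _ r0 Sy).
  by move=> r' /=; rewrite in_itv/= => /andP[].
- move=> y r /in_S Sy /andP[r0 rts].
  have tr0 : 0 <= t - r by rewrite subr_ge0 (le_trans rts) // gerBl.
  rewrite -subr_ge0; have := phi_generator tr0 Sy; rewrite -oppr_ge0.
  congr (_ <= _); rewrite /qu /w; rewrite opprD -addrA; congr (_ + _).
  rewrite -!sumrN -!big_split/=; apply: eq_bigr => v _; ring.
- move=> y yS; rewrite /w subr0 subr_ge0 /u (bigD1_seq y) //=;
    last exact: fset_uniq.
  rewrite p0 ?eqxx; [|exact: in_S..].
  rewrite mulr1 big_seq_cond big1 ?addr0 // => x' /andP[/in_S Sx' x'y].
  by rewrite (p0 _ _ (in_S yS) Sx') eq_sym (negbTE x'y) mulr0.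
Qed.

(** By the Markov property, conditioning at time [s] replaces [phi t] by its
image under the transition function, which [backward_comparison] bounds by
[phi s]. *)
Lemma mean_on_nonincreasing s t B : 0 <= s <= t -> natural_filtration Y s B ->
  mean_on B t (phi t) <= mean_on B s (phi s).
Proof.
move=> /andP[s0 st] FB; have t0 := le_trans s0 st.
have [p [p0 pd pY]] := jump_markov markovY.
have mB := filtration_measurable FB.
have PE x' : x' \in (fset_set S : seq E) ->
    fine (P (B `&` [set w | Y w t = x'])) = \sum_(x <- fset_set S)
      fine (P (B `&` [set w | Y w s = x])) * p (t - s) x x'.
  move=> /in_S Sx'; rewrite -(@mean_on1 _ s) //; last first.
    by apply: measurableI => //; exact: state_measurable.
  rewrite big_seq [RHS]big_seq; apply: eq_bigr => x /in_S Sx.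
  rewrite setIAC pY ?s0 // fineM //; apply: fin_num_measure.
  by apply: measurableI => //; exact: state_measurable.
rewrite /mean_on big_seq; under eq_bigr => x' x'S do rewrite PE // mulr_sumr.
rewrite -big_seq exchange_big /= big_seq [leRHS]big_seq.
apply: ler_sum => x /in_S Sx.
under eq_bigr do rewrite mulrCA mulrC.
rewrite -mulr_suml ler_wpM2r //; apply: backward_comparison => //.
by rewrite s0.
Qed.

(** Write [G j] for the event that [phi] stays below [a] at the times
[ts 0, ..., ts j]. The mean of [phi] on [G j], plus [a] times the probability of
the complement of [G j], does not increase with [j]: passing from [j] to [j + 1]
first lowers the mean, by the supermartingale property on [G j], and then
trades the part of [G j] on which [phi] reaches [a] for [a] times its
probability. *)
Lemma discrete_maximal_inequality (ts : nat -> R) (a : R) (m : nat) :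
  ts 0%N = 0 -> {homo ts : i j / (i <= j)%N >-> i <= j} -> 0 <= a ->
  a * fine (P (~` [set w | forall i, (i <= m)%N ->
                   phi (ts i) (Y w (ts i)) < a])) <= mean_on setT 0 (phi 0).
Proof.
move=> ts0 tsm a0.
have tsge0 i : 0 <= ts i by rewrite -ts0 tsm.
pose G m := [set w | forall i, (i <= m)%N -> phi (ts i) (Y w (ts i)) < a].
pose H i := [set w | phi (ts i) (Y w (ts i)) < a].
have FH i j : (i <= j)%N -> natural_filtration Y (ts j) (H i).
  move=> ij; apply: (@filtration_state _ _ [set x | phi (ts i) x < a]).
  by rewrite tsge0 tsm.
have GS j : G j.+1 = G j `&` H j.+1.
  apply/seteqP; split => [w Gw|w [Gw Hw] i].
    by split=> [i ij|]; apply: Gw; rewrite // (leq_trans ij).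
  by rewrite leq_eqVlt => /orP[/eqP -> //|]; exact: Gw.
have G0 : G 0%N = H 0%N.
  apply/seteqP; split => [w /(_ 0%N (leqnn _)) //|w Hw i].
  by rewrite leqn0 => /eqP ->.
have FG j : natural_filtration Y (ts j) (G j).
  elim: j => [|j IH]; first by rewrite G0; exact: FH.
  rewrite GS; apply: filtrationI; last exact: FH.
  by apply: filtration_nondecreasing IH; exact: tsm.
have mG j := filtration_measurable (FG j).
have mH j := filtration_measurable (FH j j (leqnn _)).
have step B j : measurable B ->
    a * fine (P (B `\` H j)) + mean_on (B `&` H j) (ts j) (phi (ts j)) <=
    mean_on B (ts j) (phi (ts j)).
  move=> mB; rewrite -{3}(setUIDK B (H j)) mean_onU //.
  - by rewrite addrC lerD2l mean_on_ge //; [exact: measurableD|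
      move=> w [_ /negP]; rewrite -leNgt].
  - exact: measurableI.
  - exact: measurableD.
  - by rewrite setDE setIACA setICr setI0.
suff : a * fine (P (~` G m)) + mean_on (G m) (ts m) (phi (ts m)) <=
    mean_on setT 0 (phi 0).
  apply: le_trans; rewrite lerDl -[leLHS](mul0r (fine (P (G m)))).
  apply: mean_on_ge => // w _; apply: phi_ge0 => //.
  exact: (jump_state markovY).
elim: m => [|m IH].
  by have := step setT 0%N measurableT; rewrite G0 setTI setTD ts0.
apply: le_trans IH; rewrite GS.
have -> : ~` (G m `&` H m.+1) = ~` G m `|` (G m `\` H m.+1).
  by rewrite setCI setDE setUIr setUCl setTI.
rewrite fine_PU; [|exact: measurableC|exact: measurableD|]; last first.
  by apply/seteqP; split => // w [nG [Gw _]].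
rewrite mulrDr -addrA lerD2l; apply: le_trans (step (G m) m.+1 (mG m)) _.
by apply: mean_on_nonincreasing; [rewrite tsge0 tsm|exact: FG].
Qed.

(* A finite subset of a metric space is discrete, so that a right-continuous
   path with values in it is locally constant on the right. *)
Let right_constant w t : 0 <= t -> \forall s \near t^'+, Y w s = Y w t.
Proof.
move=> t0; have cl : closed (S `\ Y w t).
  have acc : accessible_space E by exact/hausdorff_accessible/metric_hausdorff.
  by apply: (accessible_finite_set_closed.1 acc); exact: finite_setD.
have nb : nbhs (Y w t) (~` (S `\ Y w t)).
  by apply: open_nbhs_nbhs; split; [exact: closed_openC|move=> [_ /(_ erefl)]].
have H : \forall s \near t^'+, (~` (S `\ Y w t)) (Y w s) :=
  cadlag_right t0 nb.
near=> s; have st : t < s by near: s; exact: nbhs_right_gt.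
apply: contrapT => YY; have : (~` (S `\ Y w t)) (Y w s) by near: s.
apply; split => //; apply: (jump_state markovY).
exact: ltW (le_lt_trans t0 st).
Unshelve. all: by end_near. Qed.

(** The maximal inequality over all of [0, +oo[. The grids [i / 2^l] with
[i <= l 2^l] increase with [l] to the set of nonnegative dyadic numbers, which
gives the bound for dyadic times. Since the path is constant on the right of
every time and [phi] is continuous in time, an excess over [a] at some time
would be seen at a later dyadic time. *)
Lemma supermartingale_maximal_inequality (a : R) : 0 < a ->
  exists B, [/\ measurable B,
  a * fine (P B) <= mean_on setT 0 (phi 0) &
  forall w, ~ B w -> forall t, 0 <= t -> phi t (Y w t) <= a].
Proof.
move=> a0; pose ts l i : R := i%:R / 2 ^+ l.
have ts_ge0 l i : 0 <= ts l i by rewrite divr_ge0 // exprn_ge0.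
pose G l := [set w | forall i, (i <= l * 2 ^ l)%N ->
                       phi (ts l i) (Y w (ts l i)) < a].
have mG l : measurable (G l).
  have -> : G l = \bigcap_(i in [set i | (i <= l * 2 ^ l)%N])
      [set w | phi (ts l i) (Y w (ts l i)) < a] by [].
  apply: bigcap_measurable => [|i _]; first by exists 0%N.
  apply: (@filtration_measurable (ts l i)).
  apply: (@filtration_state _ _ [set x | phi (ts l i) x < a]).
  by rewrite ts_ge0 /=.
have mGC l : measurable (~` G l) by exact: measurableC.
have PG l : a * fine (P (~` G l)) <= mean_on setT 0 (phi 0).
  apply: discrete_maximal_inequality; rewrite /ts ?mul0r ?(ltW a0) //.
  by move=> i j ij; rewrite ler_wpM2r ?ler_nat // invr_ge0 exprn_ge0.
have GS : nondecreasing_seq (fun l => ~` G l).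
  apply/nondecreasing_seqP => l; apply/subsetPset; apply: subsetC => w Gw i il.
  have -> : ts l i = ts l.+1 (2 * i)%N.
    by rewrite /ts natrM exprS invfM mulrACA divff ?mul1r // pnatr_eq0.
  apply: Gw; rewrite expnS mulnCA leq_mul2l /=.
  by rewrite (leq_trans il) // leq_mul2r leqnSn orbT.
exists (\bigcup_l ~` G l); split.
- exact: bigcup_measurable.
- have mB : measurable (\bigcup_l ~` G l) by exact: bigcup_measurable.
  rewrite mulrC -ler_pdivlMr // -lee_fin fineK; last exact: fin_num_measure.
  apply: cvge_to_le (nondecreasing_cvg_mu (mu := P) mGC mB GS) _.
  apply: nearW => l /=; rewrite -[P _]fineK; last exact: fin_num_measure.
  by rewrite lee_fin ler_pdivlMr // mulrC.
move=> w nB t t0; rewrite leNgt; apply/negP => at_.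
have Gw l : G l w by apply: contrapT => nG; apply: nB; exists l.
have Sx : S (Y w t) by exact: (jump_state markovY).
have H1 : \forall s \near t, 0 <= s -> a < phi s (Y w t).
  exact: (cvgr_gt _ (deriv_within_cvg (phi_deriv t0 Sx)) _ at_).
have H2 : \forall s \near t, t < s -> Y w s = Y w t := right_constant w t0.
have : \forall s \near t, t < s -> a < phi s (Y w s).
  near=> s => ts'; have -> : Y w s = Y w t by move: ts'; near: s.
  by have := ltW (le_lt_trans t0 ts'); near: s.
move=> /nbhs_ballP[e /= e0 te].
(* The grid of order [l] has a mesh smaller than [e] and extends beyond
   [t + 1]. *)
pose l := maxn (Num.truncn (e^-1)).+1 (Num.truncn (t + 1)).+1.
have l2 : l%:R <= 2 ^+ l :> R by rewrite -natrX ler_nat ltnW // ltn_expl.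
have le : e^-1 < 2 ^+ l.
  apply: lt_le_trans l2; apply: lt_le_trans (truncnS_gt _) _.
  by rewrite ler_nat leq_maxl.
have lt : t + 1 < l%:R.
  by apply: lt_le_trans (truncnS_gt _) _; rewrite ler_nat leq_maxr.
have l0 : 0 < 2 ^+ l :> R by rewrite exprn_gt0.
pose i := (Num.truncn (t * 2 ^+ l)).+1.
have /andP[i1 i2] : (Num.truncn (t * 2 ^+ l))%:R <= t * 2 ^+ l < i%:R.
  by apply: truncn_itv; rewrite mulr_ge0 // ltW.
have tsi : t < ts l i by rewrite /ts ltr_pdivlMr.
have iE : i%:R <= t * 2 ^+ l + 1 by rewrite /i -natr1 lerD2r.
have tsi2 : ts l i < t + e.
  rewrite /ts ltr_pdivrMr // (le_lt_trans iE) // mulrDl ltrD2l.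
  by rewrite -ltr_pdivrMl // mulr1.
have il : (i <= l * 2 ^ l)%N.
  rewrite -(ler_nat R) natrM natrX (le_trans iE) //.
  have : 1 <= 2 ^+ l :> R by rewrite exprn_ege1 // ler1n.
  by move: lt l0; nra.
have := Gw l i il; apply/negP; rewrite -leNgt ltW //; apply: te => //.
by rewrite /ball/= distrC gtr0_norm ?subr_gt0 // ltrBlDl.
Unshelve. all: by end_near. Qed.
End supermartingale.
End finite_markov_process.

Arguments mean_on {R E} S {d T} P Y B t f.

(** * The simplex and the vector field *)

Lemma term_le_sum (R : numDomainType) (X : finType) (F : X -> R) n :
  (forall i, 0 <= F i) -> F n <= \sum_i F i.
Proof. by move=> F0; rewrite (bigD1 n) //= lerDl sumr_ge0. Qed.

Section simplex_theory.
Context {R : realType} {X : finType}.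
Implicit Types x y : simplex R X.

Lemma simplex_ge0 y n : 0 <= y n.
Proof. by have /andP[/forallP/(_ n)] := valP y. Qed.

Lemma simplex_sum y : \sum_n y n = 1.
Proof. by have /andP[_ /eqP] := valP y. Qed.

Lemma simplex_le1 y n : y n <= 1.
Proof. by rewrite -(simplex_sum y); apply: term_le_sum; exact: simplex_ge0. Qed.

Lemma simplexP (f : {ffun X -> R}) : (forall n, 0 <= f n) -> \sum_n f n = 1 ->
  exists y, mass y = f.
Proof.
move=> f0 f1.
have fP : [forall n, 0 <= f n] && (\sum_n f n == 1).
  by rewrite f1 eqxx andbT; apply/forallP.
by exists (Sub f fP); rewrite /mass SubK.
Qed.

Lemma simplex_dist_coord x y n : `|x n - y n| <= simplex_dist x y.
Proof. exact: (term_le_sum (F := fun n => `|x n - y n|)). Qed.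

Lemma simplex_dist_ge0 x y : 0 <= simplex_dist x y.
Proof. exact: sumr_ge0. Qed.

Lemma simplex_dist_le2 x y : simplex_dist x y <= 2.
Proof.
have -> : 2 = \sum_n (x n + y n) :> R by rewrite big_split /= !simplex_sum.
apply: ler_sum => n _; apply: le_trans (ler_normB _ _) _.
by rewrite !ger0_norm // simplex_ge0.
Qed.

Section square_norm.
Implicit Types (g : X -> R) (v w : {ffun X -> R}).

Definition dotp g (v : X -> R) : R := \sum_n g n * v n.
Definition sqnorm (v : X -> R) : R := \sum_n v n ^+ 2.

Lemma dotpD g v w : dotp g (v + w) = dotp g v + dotp g w.
Proof.
by rewrite /dotp -big_split; apply: eq_bigr => n _; rewrite ffunE mulrDr.
Qed.

Lemma dotpN g v : dotp g (- v) = - dotp g v.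
Proof. by rewrite /dotp -sumrN; apply: eq_bigr => n _; rewrite ffunE mulrN. Qed.

Lemma sqnorm_ge0 v : 0 <= sqnorm v.
Proof. by apply: sumr_ge0 => n _; exact: sqr_ge0. Qed.

Lemma sqnormD v w : sqnorm (v + w) <= 2 * (sqnorm v + sqnorm w).
Proof.
rewrite /sqnorm -big_split mulr_sumr; apply: ler_sum => n _.
rewrite -subr_ge0 (_ : _ - _ = (v n - w n) ^+ 2) ?sqr_ge0 //=.
by rewrite ?ffunE; ring.
Qed.

Lemma sqnormB x y : sqnorm (mass x - mass y) = \sum_n (x n - y n) ^+ 2.
Proof. by apply: eq_bigr => n _; rewrite !ffunE. Qed.

Lemma sqnorm_xx x : sqnorm (mass x - mass x) = 0.
Proof. by rewrite sqnormB big1 // => n _; rewrite subrr expr0n. Qed.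

(** The Cauchy-Schwarz inequality between the distance of the simplex, which is
an l1 distance, and the Euclidean norm, whose square is smooth. *)
Lemma simplex_dist_sqnorm x y :
  simplex_dist x y ^+ 2 <= #|X|%:R * sqnorm (mass x - mass y).
Proof.
rewrite expr2 {1}/simplex_dist mulr_suml.
apply: le_trans (_ : \sum_(n : X) \sum_(m : X)
  2^-1 * ((x n - y n) ^+ 2 + (x m - y m) ^+ 2) <= _).
  apply: ler_sum => n _; rewrite mulr_sumr; apply: ler_sum => m _.
  rewrite -[(x n - y n) ^+ 2]real_normK ?num_real //.
  rewrite -[(x m - y m) ^+ 2]real_normK ?num_real //.
  have := sqr_ge0 (`|x n - y n| - `|x m - y m|).
  rewrite sqrrB; move: `|_| `|_| => a b; lra.
under eq_bigr do
  rewrite -mulr_sumr big_split /= sumr_const -[_ *+ #|X|]mulr_natl.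
rewrite -mulr_sumr big_split /= -mulr_sumr sumr_const -[_ *+ #|X|]mulr_natl.
by rewrite -sqnormB le_eqVlt; apply/orP; left; apply/eqP; field.
Qed.

Lemma sqnorm_le2 x y : sqnorm (mass x - mass y) <= 2.
Proof.
rewrite sqnormB; apply: le_trans (simplex_dist_le2 x y).
apply: ler_sum => n _; rewrite -real_normK ?num_real // expr2 ler_piMr //.
rewrite ler_norml; have := simplex_ge0 x n; have := simplex_ge0 y n.
by have := simplex_le1 x n; have := simplex_le1 y n; lra.
Qed.

Lemma sqnorm_lipschitz x x' y :
  `|sqnorm (mass x - mass y) - sqnorm (mass x' - mass y)| <=
  2 * simplex_dist x x'.
Proof.
rewrite !sqnormB -sumrB mulr_sumr; apply: le_trans (ler_norm_sum _ _ _) _.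
apply: ler_sum => n _; rewrite subr_sqr normrM mulrC.
have -> : x n - y n - (x' n - y n) = x n - x' n by ring.
rewrite ler_wpM2r // ler_norml.
have := simplex_ge0 x n; have := simplex_ge0 y n.
have := simplex_ge0 x' n; have := simplex_le1 x' n.
by have := simplex_le1 x n; have := simplex_le1 y n; lra.
Qed.

End square_norm.
End simplex_theory.

Section configurations.
Context {K C : nat} {A : 'I_K -> nat}.
Local Notation X := (config C A).
Implicit Types (n m : X) (k : 'I_K).

(** The relation [m = n + f_k], of which [incr] and [decr] are the two partial
functions; sums over it exchange the roles of [n] and [m]. *)
Definition succ k n m := [forall j, pop m j == (pop n j + (j == k))%N].

Lemma pop_inj n m : pop n =1 pop m -> n = m.
Proof. by move=> nm; apply/val_inj/ffunP => j; apply/val_inj/nm. Qed.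

Lemma succ_pop k n m : succ k n m -> pop m k = (pop n k).+1.
Proof. by move=> /forallP/(_ k)/eqP ->; rewrite eqxx addn1. Qed.

Lemma succ_injr k n m m' : succ k n m -> succ k n m' -> m = m'.
Proof.
move=> /forallP h /forallP h'; apply: pop_inj => j.
by rewrite (eqP (h j)) (eqP (h' j)).
Qed.

Lemma succ_injl k n n' m : succ k n m -> succ k n' m -> n = n'.
Proof.
move=> /forallP h /forallP h'; apply: pop_inj => j.
by apply/eqP; rewrite -(eqn_add2r (j == k)) -(eqP (h j)) -(eqP (h' j)).
Qed.

Lemma pop_le n k : (pop n k <= C)%N.
Proof. by rewrite -ltnS; exact: ltn_ord. Qed.

Lemma oapp_incr (R : pzRingType) (g : X -> R) n k :
  oapp g 0 (incr n k) = \sum_m g m * (succ k n m)%:R.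
Proof.
rewrite /incr; case: pickP => [m nm|no] /=; last first.
  by rewrite big1 // => m _; have := no m; rewrite /succ => ->; rewrite mulr0.
rewrite (bigD1 m) //= (nm : succ k n m) mulr1 big1 ?addr0 // => m' m'm.
case h : (succ k n m'); last by rewrite mulr0.
by rewrite (succ_injr nm h) eqxx in m'm.
Qed.

Lemma oapp_decr (R : pzRingType) (g : X -> R) m k :
  oapp g 0 (decr m k) = \sum_n g n * (succ k n m)%:R.
Proof.
rewrite /decr; case: pickP => [n nm|no] /=; last first.
  by rewrite big1 // => n _; have := no n; rewrite /succ => ->; rewrite mulr0.
rewrite (bigD1 n) //= (nm : succ k n m) mulr1 big1 ?addr0 // => n' n'n.
case h : (succ k n' m); last by rewrite mulr0.
by rewrite (succ_injl nm h) eqxx in n'n.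
Qed.

Lemma decr_neq_None n k : (0 < pop n k)%N -> decr n k != None.
Proof.
move=> n0.
pose f : {ffun 'I_K -> 'I_C.+1} := [ffun j => inord (pop n j - (j == k))].
have fE j : f j = (pop n j - (j == k))%N :> nat.
  by rewrite ffunE inordK // ltnS (leq_trans (leq_subr _ _)) // pop_le.
have fP : (\sum_j A j * f j <= C)%N.
  apply: leq_trans (valP n); apply: leq_sum => j _.
  by rewrite leq_mul2l fE leq_subr orbT.
rewrite /decr; case: pickP => // /(_ (Sub f fP)) /forallP[] j.
rewrite /pop SubK fE subnK //; case: eqP => // ->; exact: n0.
Qed.

Section weak_form.
Context {R : realType}.
Implicit Types g x : X -> R.

(** The increments of [g] when a customer of class [k] arrives at, or leaves, a
node in state [n]; a rejected arrival does not change the state. If [n_k = 0],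
[departure_diff] is a default value, which only occurs multiplied by [n_k]. *)
Definition arrival_diff g k n : R :=
  oapp g 0 (incr n k) - g n * (incr n k != None)%:R.
Definition departure_diff g k n : R := oapp g 0 (decr n k) - g n.

(** Adding and removing a customer are adjoint to each other; this moves the
differences in the vector field onto a test function. *)
Lemma sum_decr g x k :
  \sum_n g n * oapp x 0 (decr n k) = \sum_m x m * oapp g 0 (incr m k).
Proof.
under eq_bigr do rewrite oapp_decr mulr_sumr.
under [RHS]eq_bigr do rewrite oapp_incr mulr_sumr.
rewrite exchange_big; apply: eq_bigr => n _; apply: eq_bigr => m _ /=.
by rewrite mulrCA.
Qed.

Lemma sum_incr g x k :
  \sum_n g n * ((pop n k).+1%:R * oapp x 0 (incr n k)) =
  \sum_m (pop m k)%:R * x m * oapp g 0 (decr m k).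
Proof.
under eq_bigr do rewrite oapp_incr !mulr_sumr.
under [RHS]eq_bigr do rewrite oapp_decr mulr_sumr.
rewrite exchange_big; apply: eq_bigr => m _; apply: eq_bigr => n _ /=.
case h : (succ k n m); last by rewrite !mulr0.
by rewrite (succ_pop h); ring.
Qed.

End weak_form.
End configurations.

(** A crude constant that serves as a bound for [V], as a Lipschitz constant and
as a bound for the rate at which mass leaves a state. *)
Definition rate_bound (R : realType) (K C : nat) (lambda gamma mu : 'I_K -> R)
    : R :=
  \sum_k (lambda k + gamma k + mu k) * (5 * C.+1)%:R.

Section vector_field.
Context {R : realType} {K C : nat} {A : 'I_K -> nat}.
Context {lambda gamma mu : 'I_K -> R}.
Hypothesis lambda_ge0 : forall k, 0 <= lambda k.
Hypothesis gamma_ge0 : forall k, 0 <= gamma k.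
Hypothesis mu_ge0 : forall k, 0 <= mu k.
Local Notation X := (config C A).
Local Notation V := (V lambda gamma mu).
Local Notation c0 := (rate_bound C lambda gamma mu).
Implicit Types (x y : simplex R X) (g : X -> R).

(** In weak form [V y] is the forward operator of a single node that receives
customers of class [k] at the rate [lambda k + gamma k * mean_pop k y] and loses
each of them at the rate [gamma k + mu k]. *)
Lemma V_weak y g : \sum_n g n * V y n =
  \sum_k (lambda k + gamma k * mean_pop k y) * \sum_m y m * arrival_diff g k m +
  \sum_k (gamma k + mu k) * \sum_m (pop m k)%:R * y m * departure_diff g k m.
Proof.
rewrite /V; under eq_bigr do rewrite mulrDr !mulr_sumr.
rewrite big_split /=.
congr (_ + _); rewrite exchange_big; apply: eq_bigr => k _ /=.
  under eq_bigr do rewrite mulrCA mulrBr.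
  rewrite -mulr_sumr sumrB sum_decr -sumrB; congr (_ * _).
  by apply: eq_bigr => m _; rewrite /arrival_diff; ring.
under eq_bigr do rewrite mulrCA mulrBr.
rewrite -mulr_sumr sumrB sum_incr -sumrB; congr (_ * _).
by apply: eq_bigr => m _; rewrite /departure_diff; ring.
Qed.

Lemma arrival_diff_cst (c : R) k (n : X) : arrival_diff (fun=> c) k n = 0.
Proof.
by rewrite /arrival_diff; case: incr => [m|] /=; rewrite ?mulr1 ?mulr0 subrr.
Qed.

Lemma pop_departure_diff_cst (c : R) k (n : X) :
  (pop n k)%:R * departure_diff (fun=> c) k n = 0.
Proof.
have [->|] := posnP (pop n k); first by rewrite mul0r.
move=> /decr_neq_None; rewrite /departure_diff; case: decr => //= m _.
by rewrite subrr mulr0.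
Qed.

Lemma V_sum0 y : \sum_n V y n = 0.
Proof.
have := V_weak y (fun=> 1); under eq_bigr do rewrite mul1r; move=> ->.
rewrite [X in X + _]big1 ?[X in _ + X]big1 ?addr0 // => k _.
  by rewrite big1 ?mulr0 // => m _; rewrite mulrAC pop_departure_diff_cst mul0r.
by rewrite big1 ?mulr0 // => m _; rewrite arrival_diff_cst mulr0.
Qed.

Lemma mean_pop_ge0 k y : 0 <= mean_pop k y.
Proof. by apply: sumr_ge0 => m _; rewrite mulr_ge0 // simplex_ge0. Qed.

Lemma mean_pop_le k y : mean_pop k y <= C%:R.
Proof.
have -> : C%:R = \sum_m C%:R * y m :> R by rewrite -mulr_sumr simplex_sum mulr1.
apply: ler_sum => m _.
by rewrite ler_wpM2r ?simplex_ge0 // ler_nat pop_le.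
Qed.

Lemma mean_pop_lipschitz k x y :
  `|mean_pop k x - mean_pop k y| <= C%:R * simplex_dist x y.
Proof.
rewrite /mean_pop -sumrB; apply: le_trans (ler_norm_sum _ _ _) _.
rewrite /simplex_dist mulr_sumr; apply: ler_sum => m _.
by rewrite -mulrBr normrM normr_nat ler_wpM2r // ler_nat pop_le.
Qed.

Lemma oapp_simplex_bound y (o : option X) : 0 <= oapp y 0 o <= 1.
Proof.
by case: o => [n|] /=; rewrite ?simplex_ge0 ?simplex_le1 ?lexx ?ler01.
Qed.

Lemma oapp_simplex_lipschitz x y (o : option X) :
  `|oapp x 0 o - oapp y 0 o| <= simplex_dist x y.
Proof.
case: o => [n|] /=; first exact: simplex_dist_coord.
by rewrite subrr normr0 simplex_dist_ge0.
Qed.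

Lemma rate_bound_ge0 : 0 <= c0.
Proof. by apply: sumr_ge0 => k _; rewrite mulr_ge0 // !addr_ge0. Qed.

Let rates_ge0 k :
  0 <= lambda k * C%:R /\ 0 <= gamma k * C%:R /\ 0 <= mu k * C%:R.
Proof. by do !split; rewrite mulr_ge0. Qed.

Let popR_le (n : X) k : (pop n k)%:R <= C%:R :> R.
Proof. by rewrite ler_nat pop_le. Qed.

Let indicator_le1 (b : bool) : 0 <= (b%:R : R) <= 1.
Proof. by case: b; rewrite ?lexx ?ler01. Qed.

Let arrival_le1 y n k :
  `|oapp y 0 (decr n k) - y n * (incr n k != None)%:R| <= 1.
Proof.
have /andP[] := oapp_simplex_bound y (decr n k).
have /andP[i0 i1] := indicator_le1 (incr n k != None).
have := mulr_ge0 (simplex_ge0 y n) i0.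
have := mulr_ile1 (simplex_ge0 y n) i0 (simplex_le1 y n) i1.
by rewrite ler_norml => *; lra.
Qed.

Let arrival_factor_le y k : `|lambda k + gamma k * mean_pop k y| <=
  lambda k + gamma k * C%:R.
Proof.
rewrite ger0_norm ?addr_ge0 ?mulr_ge0 ?mean_pop_ge0 //.
by rewrite lerD2l ler_wpM2l // mean_pop_le.
Qed.

Lemma V_bound y n : `|V y n| <= c0.
Proof.
rewrite /V /rate_bound -big_split /=; apply: le_trans (ler_norm_sum _ _ _) _.
apply: ler_sum => k _; have [la_C [ga_C mu_C]] := rates_ge0 k.
have la0 := lambda_ge0 k; have ga0 := gamma_ge0 k; have mu0 := mu_ge0 k.
have arrival_factor := arrival_factor_le y k.
have arrival := arrival_le1 y n k.
have departure : `|(pop n k).+1%:R * oapp y 0 (incr n k) - (pop n k)%:R * y n|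
    <= C%:R + 1.
  have /andP[h0 h1] := oapp_simplex_bound y (incr n k).
  have := ler_wpM2l (ler0n R (pop n k).+1) h1.
  have := mulr_ge0 (ler0n R (pop n k).+1) h0.
  have := ler_wpM2l (ler0n R (pop n k)) (simplex_le1 y n).
  have := mulr_ge0 (ler0n R (pop n k)) (simplex_ge0 y n).
  have := popR_le n k; rewrite ler_norml -natr1 !mulr1.
  by move=> *; lra.
have := ler_pM (normr_ge0 _) (normr_ge0 _) arrival_factor arrival.
have depf : `|gamma k + mu k| <= gamma k + mu k by rewrite ger0_norm ?addr_ge0.
have := ler_pM (normr_ge0 _) (normr_ge0 _) depf departure.
rewrite -!normrM => dep arr; apply: le_trans (ler_normD _ _) _.
apply: le_trans (lerD arr dep) _; rewrite natrM -(natr1 C); lra.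
Qed.

Lemma V_lipschitz x y n : `|V x n - V y n| <= c0 * simplex_dist x y.
Proof.
rewrite /V /rate_bound opprD addrACA -!sumrB -big_split mulr_suml /=.
apply: le_trans (ler_norm_sum _ _ _) _.
apply: ler_sum => k _; have [la_C [ga_C mu_C]] := rates_ge0 k.
have la0 := lambda_ge0 k; have ga0 := gamma_ge0 k; have mu0 := mu_ge0 k.
have dist0 := simplex_dist_ge0 x y.
have arrival : `|(oapp x 0 (decr n k) - x n * (incr n k != None)%:R) -
    (oapp y 0 (decr n k) - y n * (incr n k != None)%:R)| <=
    2 * simplex_dist x y.
  have -> : (oapp x 0 (decr n k) - x n * (incr n k != None)%:R) -
    (oapp y 0 (decr n k) - y n * (incr n k != None)%:R) =
    (oapp x 0 (decr n k) - oapp y 0 (decr n k)) -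
    (x n - y n) * (incr n k != None)%:R by ring.
  rewrite mulr_natl mulr2n; apply: le_trans (ler_normB _ _) _.
  apply: lerD; first exact: oapp_simplex_lipschitz.
  have /andP[i0 i1] := indicator_le1 (incr n k != None).
  rewrite normrM (ger0_norm i0) -[leRHS]mulr1.
  by apply: ler_pM => //; exact: simplex_dist_coord.
have departure : `|((pop n k).+1%:R * oapp x 0 (incr n k) - (pop n k)%:R * x n)
    - ((pop n k).+1%:R * oapp y 0 (incr n k) - (pop n k)%:R * y n)|
    <= (2 * C%:R + 1) * simplex_dist x y.
  have -> : ((pop n k).+1%:R * oapp x 0 (incr n k) - (pop n k)%:R * x n)
    - ((pop n k).+1%:R * oapp y 0 (incr n k) - (pop n k)%:R * y n) =
    (pop n k).+1%:R * (oapp x 0 (incr n k) - oapp y 0 (incr n k))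
    - (pop n k)%:R * (x n - y n) by ring.
  have -> : 2 * C%:R + 1 = (C%:R + 1) + C%:R :> R by ring.
  rewrite mulrDl; apply: le_trans (ler_normB _ _) _.
  apply: lerD; rewrite normrM normr_nat; apply: ler_pM => //.
  - by rewrite -natr1 lerD2r.
  - exact: oapp_simplex_lipschitz.
  - exact: simplex_dist_coord.
pose ax := oapp x 0 (decr n k) - x n * (incr n k != None)%:R.
pose ay := oapp y 0 (decr n k) - y n * (incr n k != None)%:R.
have arr : `|(lambda k + gamma k * mean_pop k x) * ax -
    (lambda k + gamma k * mean_pop k y) * ay| <=
    (lambda k + gamma k * C%:R) * (2 * simplex_dist x y) +
    gamma k * (C%:R * simplex_dist x y) * 1.
  have -> : (lambda k + gamma k * mean_pop k x) * ax -
    (lambda k + gamma k * mean_pop k y) * ay =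
    (lambda k + gamma k * mean_pop k x) * (ax - ay) +
    gamma k * (mean_pop k x - mean_pop k y) * ay by ring.
  apply: le_trans (ler_normD _ _) _; apply: lerD; rewrite normrM.
    by apply: ler_pM => //; exact: arrival_factor_le.
  apply: ler_pM => //; last exact: arrival_le1.
  by rewrite normrM ger0_norm // ler_wpM2l // mean_pop_lipschitz.
have dep : `|(gamma k + mu k) * (((pop n k).+1%:R * oapp x 0 (incr n k) -
    (pop n k)%:R * x n) - ((pop n k).+1%:R * oapp y 0 (incr n k) -
    (pop n k)%:R * y n))| <=
    (gamma k + mu k) * ((2 * C%:R + 1) * simplex_dist x y).
  by rewrite normrM ger0_norm ?addr_ge0 // ler_wpM2l // addr_ge0.
rewrite -mulrBr; apply: le_trans (ler_normD _ _) _.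
apply: le_trans (lerD arr dep) _; rewrite natrM -(natr1 C) -subr_ge0.
have -> : (lambda k + gamma k + mu k) * (5 * (C%:R + 1)) * simplex_dist x y -
  ((lambda k + gamma k * C%:R) * (2 * simplex_dist x y) +
   gamma k * (C%:R * simplex_dist x y) * 1 +
   (gamma k + mu k) * ((2 * C%:R + 1) * simplex_dist x y)) =
  (5 * (lambda k * C%:R) + 3 * (mu k * C%:R) + 3 * lambda k + 4 * gamma k +
   4 * mu k) * simplex_dist x y by ring.
by apply: mulr_ge0 => //; lra.
Qed.

(** The only negative terms of [V y n] come from the mass that leaves [n], which
is proportional to [y n]; small Euler steps therefore preserve positivity. *)
Lemma V_ge y n : - (c0 * y n) <= V y n.
Proof.
rewrite /V /rate_bound -big_split mulr_suml -sumrN; apply: ler_sum => k _ /=.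
have [la_C [ga_C mu_C]] := rates_ge0 k.
have la0 := lambda_ge0 k; have ga0 := gamma_ge0 k; have mu0 := mu_ge0 k.
have v0 := simplex_ge0 y n.
have /andP[b0 _] := oapp_simplex_bound y (decr n k).
have /andP[h0 _] := oapp_simplex_bound y (incr n k).
have /andP[i0 i1] := indicator_le1 (incr n k != None).
have F0 : 0 <= lambda k + gamma k * mean_pop k y.
  by rewrite addr_ge0 ?mulr_ge0 ?mean_pop_ge0.
have F1 : lambda k + gamma k * mean_pop k y <= lambda k + gamma k * C%:R.
  by apply: le_trans (arrival_factor_le y k); exact: ler_norm.
have arr : - ((lambda k + gamma k * C%:R) * y n) <=
    (lambda k + gamma k * mean_pop k y) *
    (oapp y 0 (decr n k) - y n * (incr n k != None)%:R).
  rewrite mulrBr; apply: le_trans (lerB (mulr_ge0 F0 b0) (lexx _)).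
  rewrite sub0r lerN2; apply: ler_pM => //; first by rewrite mulr_ge0.
  by rewrite ler_piMr.
have dep : - ((gamma k + mu k) * (C%:R * y n)) <= (gamma k + mu k) *
    ((pop n k).+1%:R * oapp y 0 (incr n k) - (pop n k)%:R * y n).
  rewrite -mulrN ler_wpM2l ?addr_ge0 // -[leLHS]add0r lerB //.
    by rewrite mulr_ge0.
  by rewrite ler_wpM2r.
apply: le_trans (lerD arr dep); rewrite natrM -(natr1 C) -subr_ge0.
have -> : - ((lambda k + gamma k * C%:R) * y n) -
  (gamma k + mu k) * (C%:R * y n) -
  - ((lambda k + gamma k + mu k) * (5 * (C%:R + 1)) * y n) =
  (5 * (lambda k * C%:R) + 3 * (gamma k * C%:R) + 4 * (mu k * C%:R) +
   4 * lambda k + 5 * gamma k + 5 * mu k) * y n by ring.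
by apply: mulr_ge0 => //; lra.
Qed.
End vector_field.

(** * Differential equations on the simplex *)

Lemma cvg_sumr (R : realType) (T I : Type) (F : set_system T) (r : seq I)
    (f : I -> T -> R) (a : I -> R) : Filter F ->
  (forall i, f i x @[x --> F] --> a i) ->
  \sum_(i <- r) f i x @[x --> F] --> \sum_(i <- r) a i.
Proof.
move=> FF fa; elim: r => [|i r IH].
  by under eq_fun do rewrite big_nil; rewrite big_nil; exact: cvg_cst.
by under eq_fun do rewrite big_cons; rewrite big_cons; exact: cvgD.
Qed.

Section ode_on_simplex.
Context {R : realType} {X : finType}.
Variables (V : simplex R X -> X -> R) (c : R).
Implicit Types (x y z : simplex R X) (h t : R) (j k : nat) (n : X).
Hypothesis c_ge0 : 0 <= c.
Hypothesis V_bounded : forall y n, `|V y n| <= c.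
Hypothesis V_lip : forall x y n, `|V x n - V y n| <= c * simplex_dist x y.
Hypothesis V_inward : forall y n, - (c * y n) <= V y n.
Hypothesis V_sum : forall y, \sum_n V y n = 0.

Let B := #|X|%:R * c.
Let B_ge0 : 0 <= B. Proof. exact: mulr_ge0. Qed.

Let h0 := (1 + c)^-1.
Let h0_gt0 : 0 < h0. Proof. by rewrite invr_gt0 ltr_wpDr. Qed.

Let sum_bound (f : X -> R) b : (forall n, `|f n| <= c * b) ->
  \sum_n `|f n| <= B * b.
Proof.
move=> fb; apply: le_trans (ler_sum _ (fun n _ => fb n)) _.
by rewrite sumr_const -mulr_natl mulrA.
Qed.

Let V1 y : \sum_n `|V y n| <= B.
Proof. by rewrite -[leRHS]mulr1; apply: sum_bound => n; rewrite mulr1. Qed.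

Let V_lip1 x y : \sum_n `|V x n - V y n| <= B * simplex_dist x y.
Proof. by apply: sum_bound => n. Qed.

(** The default value of [insubd] is not reached when [0 <= h <= h0], by
[eulerE]: the scheme stays in the simplex by itself. *)
Definition euler h y : simplex R X := insubd y [ffun n => y n + h * V y n].

Lemma eulerE h y n : 0 <= h <= h0 -> euler h y n = y n + h * V y n.
Proof.
move=> /andP[hge0 hh]; rewrite /euler /mass val_insubd ifT ?ffunE //.
apply/andP; split; last first.
  under eq_bigr do rewrite ffunE.
  by rewrite big_split /= -mulr_sumr V_sum mulr0 addr0 simplex_sum.
apply/forallP => m; rewrite ffunE.
have hc : h * c <= 1.
  have : h * (1 + c) <= 1 by rewrite -ler_pdivlMr ?div1r // ltr_wpDr.
  by apply: le_trans; rewrite ler_wpM2l // lerDr.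
apply: le_trans (lerD (lexx _) (ler_wpM2l hge0 (V_inward y m))).
by rewrite mulrN mulrA subr_ge0 ler_piMl // simplex_ge0.
Qed.

Let dist_sym x y : simplex_dist x y = simplex_dist y x.
Proof. by apply: eq_bigr => n _; rewrite distrC. Qed.

Let dist_xx x : simplex_dist x x = 0.
Proof. exact: (mdistxx (x : simplex R X)). Qed.

Let dist_tri x y z : simplex_dist x z <= simplex_dist x y + simplex_dist y z.
Proof. exact: (metric_triangle (x : simplex R X) y z). Qed.

Lemma iter_euler_drift h y j : 0 <= h <= h0 ->
  simplex_dist (iter j (euler h) y) y <= j%:R * h * B.
Proof.
move=> hh; have /andP[hge0 _] := hh; elim: j => [|j IH].
  by rewrite /= !mul0r dist_xx.
apply: le_trans (dist_tri _ (iter j (euler h) y) _) _.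
rewrite iterS -natr1 !mulrDl mul1r addrC; apply: lerD => //.
rewrite /simplex_dist.
under eq_bigr do rewrite eulerE // addrAC subrr add0r normrM.
by rewrite -mulr_sumr ger0_norm // ler_wpM2l.
Qed.

(** Uniformly in the step, the scheme follows the tangent [V y] up to the square
of the elapsed time [j h]; this estimate survives the passage to the limit and
contains the derivative of the flow. *)
Lemma iter_euler_linear h y j : 0 <= h <= h0 ->
  \sum_n `|iter j (euler h) y n - y n - j%:R * h * V y n| <=
  B ^+ 2 * (j%:R * h) ^+ 2.
Proof.
move=> hh; have /andP[hge0 _] := hh; elim: j => [|j IH].
  rewrite big1 ?mul0r ?expr0n ?mulr0 // => n _.
  by rewrite /= subrr !mul0r subr0 normr0.
set x := iter j (euler h) y in IH *.
have -> : B ^+ 2 * (j.+1%:R * h) ^+ 2 = B ^+ 2 * (j%:R * h) ^+ 2 +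
    h * (B * (j%:R * h * B)) + B ^+ 2 * h ^+ 2 * (j.+1%:R).
  by rewrite -(natr1 j); ring.
rewrite -[leLHS]addr0; apply: lerD; last by rewrite !mulr_ge0 ?exprn_ge0.
apply: le_trans (_ : \sum_n (`|x n - y n - j%:R * h * V y n| +
    h * `|V x n - V y n|) <= _).
  apply: ler_sum => n _; rewrite iterS -/x eulerE //.
  have -> : x n + h * V x n - y n - j.+1%:R * h * V y n =
      (x n - y n - j%:R * h * V y n) + h * (V x n - V y n).
    by rewrite -(natr1 j); ring.
  by apply: le_trans (ler_normD _ _) _; rewrite normrM (ger0_norm hge0).
rewrite big_split /= -mulr_sumr; apply: lerD => //; rewrite ler_wpM2l //.
apply: le_trans (V_lip1 _ _) _; rewrite ler_wpM2l //.
exact: iter_euler_drift.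
Qed.

(** Halving the step changes the position at a given time by a quantity of the
order of the step. The bound solves the recursion
[e_(j+1) = (1 + h B) e_j + (h B)^2], whose last term bounds the error of one
step. *)
Lemma iter_euler_half h y j : 0 <= h <= h0 ->
  simplex_dist (iter j.*2 (euler (h / 2)) y) (iter j (euler h) y) <=
  h * B * ((1 + h * B) ^+ j - 1).
Proof.
move=> hh; have /andP[hge0 hle] := hh.
have h2 : 0 <= h / 2 <= h0.
  by rewrite divr_ge0 //= (le_trans _ hle) // ler_pdivrMr // ler_peMr // ler1n.
elim: j => [|j IH].
  by rewrite /= subrr mulr0 dist_xx.
rewrite doubleS !iterS.
set x' := iter j.*2 _ y in IH *; set x := iter j _ y in IH *.
have hB0 : 0 <= h * B by rewrite mulr_ge0.
have -> : h * B * ((1 + h * B) ^+ j.+1 - 1) =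
    (1 + h * B) * (h * B * ((1 + h * B) ^+ j - 1)) + h * B * (h * B).
  by rewrite exprS; ring.
apply: le_trans (_ : (1 + h * B) * simplex_dist x' x + h * B * (h * B) <= _);
  last by rewrite lerD2r ler_wpM2l // addr_ge0.
apply: le_trans (_ : \sum_n (`|x' n - x n| + h * `|V x' n - V x n| +
    h * `|V (euler (h / 2) x') n - V x' n|) <= _).
  apply: ler_sum => n _; rewrite !eulerE //.
  have -> : x' n + h / 2 * V x' n + h / 2 * V (euler (h / 2) x') n -
      (x n + h * V x n) = (x' n - x n) + h * (V x' n - V x n) +
      h / 2 * (V (euler (h / 2) x') n - V x' n) by field.
  apply: le_trans (ler_normD _ _) _; apply: lerD.
    by apply: le_trans (ler_normD _ _) _; rewrite normrM (ger0_norm hge0).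
  have /andP[h20 _] := h2; rewrite normrM (ger0_norm h20) ler_wpM2r //.
  by rewrite ler_pdivrMr // ler_peMr // ler1n.
rewrite !big_split /= -!mulr_sumr mulrDl mul1r; apply: lerD.
  by rewrite lerD2l -mulrA ler_wpM2l.
rewrite -mulrA ler_wpM2l //; apply: le_trans (V_lip1 _ _) _.
rewrite ler_wpM2l //; apply: le_trans (iter_euler_drift _ 1 h2) _.
by rewrite mul1r ler_wpM2r // ler_pdivrMr // ler_peMr // ler1n.
Qed.

Variable z : simplex R X.

Let hk k : R := h0 / 2 ^+ k.
Let hk_gt0 k : 0 < hk k. Proof. by rewrite divr_gt0 // exprn_gt0. Qed.
Let hkS k : hk k.+1 = hk k / 2.
Proof. by rewrite /hk exprS invfM mulrCA mulrC. Qed.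
Let hk_le k : 0 <= hk k <= h0.
Proof.
rewrite ltW //=; elim: k => [|k IH]; first by rewrite /hk expr0 divr1.
by apply: le_trans IH; rewrite hkS ler_pdivrMr // ler_peMr ?ltW // ltr1n.
Qed.

Let steps k t := Num.truncn (t / hk k).

Let approx k t := iter (steps k t) (euler (hk k)) z.

Let steps_itv k t : 0 <= t ->
  (steps k t)%:R * hk k <= t < (steps k t)%:R * hk k + hk k.
Proof.
move=> t0; have /andP[t1 t2] := truncn_itv (divr_ge0 t0 (ltW (hk_gt0 k))).
rewrite -ler_pdivlMr // t1 /=.
by rewrite -[X in _ < _ + X]mul1r -mulrDl -ltr_pdivrMr // natr1.
Qed.

Let approx_step k t : 0 <= t ->
  simplex_dist (approx k.+1 t) (approx k t) <= hk k * (B * expR (B * t)).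
Proof.
move=> t0; have hk0 := ltW (hk_gt0 k).
have /andP[t1 t2] := steps_itv k t0.
set m := steps k t in t1 t2 *.
have hB0 : 0 <= hk k * B by rewrite mulr_ge0.
have exp_m : (1 + hk k * B) ^+ m <= expR (B * t).
  apply: le_trans (_ : expR (hk k * B) ^+ m <= _).
    apply: lerXn2r; rewrite ?nnegrE ?expR_ge0 ?addr_ge0 //.
    exact: expR_ge1Dx.
  rewrite -expRM_natl ler_expR mulrCA mulrA mulrC ler_wpM2l //.
  by rewrite mulrC.
rewrite mulrA; apply: le_trans (ler_wpM2l hB0 exp_m).
have even_step := iter_euler_half z m (hk_le k).
rewrite -hkS in even_step.
(* In the finer grid the last point before [t] has index [2m] or [2m + 1]. *)
have [th|th] := ltP t (m%:R * hk k + hk k / 2).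
  have -> : approx k.+1 t = iter m.*2 (euler (hk k.+1)) z.
    congr iter; apply: truncn_def; rewrite ler_pdivlMr // ltr_pdivrMr //.
    rewrite -(natr1 m.*2) -muln2 natrM hkS.
    by apply/andP; split; [apply: le_trans t1|apply: lt_le_trans th _];
      rewrite le_eqVlt; apply/orP; left; apply/eqP; field.
  by apply: le_trans even_step _; rewrite ler_wpM2l // gerBl.
have -> : approx k.+1 t = iter m.*2.+1 (euler (hk k.+1)) z.
  congr iter; apply: truncn_def; rewrite ler_pdivlMr // ltr_pdivrMr //.
  rewrite -(natr1 m.*2.+1) -(natr1 m.*2) -muln2 natrM hkS.
  by apply/andP; split; [apply: le_trans th|apply: lt_le_trans t2 _];
    rewrite le_eqVlt; apply/orP; left; apply/eqP; field.
apply: le_trans (dist_tri _ (iter m.*2 (euler (hk k.+1)) z) _) _.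
apply: le_trans (lerD (iter_euler_drift _ 1 (hk_le k.+1)) even_step) _.
rewrite mul1r mulrBr mulr1 addrCA gerDl subr_le0 ler_wpM2r //.
by rewrite hkS ler_pdivrMr // ler_peMr // ler1n.
Qed.

Let hk_cvg0 : hk k @[k --> \oo] --> (0 : R).
Proof.
have -> : hk = geometric h0 (2^-1).
  by apply/funext => k; rewrite /hk /geometric /= exprVn.
by apply: cvg_geometric; rewrite ger0_norm ?invr_ge0 // invf_lt1 // ltr1n.
Qed.

Let approx_coord_cvg t n : 0 <= t -> cvgn (fun k => approx k t n).
Proof.
move=> t0; pose D := B * expR (B * t).
have D0 : 0 <= D by rewrite mulr_ge0 // expR_ge0.
(* The increments of [approx k t n] are at most [D * hk k], and [hk] is
   geometric of ratio 1/2: the sum with [2 * D * hk k] is monotone. *)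
pose u k := approx k t n + 2 * D * hk k.
have cu : cvgn u.
  apply: nonincreasing_is_cvgn; last first.
    exists 0 => _ [k _ <-]; rewrite addr_ge0 ?simplex_ge0 //.
    by rewrite !mulr_ge0 // ltW.
  apply/nonincreasing_seqP => k; rewrite /u hkS.
  have := le_trans (simplex_dist_coord _ _ n) (approx_step k t0).
  by move=> /ler_normlP[_]; rewrite -/D; lra.
have -> : (fun k => approx k t n) = (fun k => u k - 2 * D * hk k).
  by apply/funext => k; rewrite /u addrK.
by apply: is_cvgB => //; apply: is_cvgMr; apply/cvg_ex; exists 0.
Qed.

Let approx_cvg t : 0 <= t ->
  exists y : simplex R X, forall n, approx k t n @[k --> \oo] --> y n.
Proof.
move=> t0.
have [||y yE] := @simplexP R X [ffun n => limn (fun k => approx k t n)].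
- move=> n; rewrite ffunE; apply: limr_ge; first exact: approx_coord_cvg.
  by apply: nearW => k; exact: simplex_ge0.
- under eq_bigr do rewrite ffunE.
  have H : \sum_n approx k t n @[k --> \oo] -->
      \sum_n limn (fun k => approx k t n).
    by apply: cvg_sumr => n; exact: approx_coord_cvg.
  rewrite -(cvg_lim (@Rhausdorff R) H).
  under eq_fun do rewrite simplex_sum.
  exact: lim_cst.
- by exists y => n; rewrite yE ffunE; exact: approx_coord_cvg.
Qed.

Lemma flow_exists : exists y : R -> simplex R X, forall t n, 0 <= t ->
  approx k t n @[k --> \oo] --> y t n.
Proof.
suff /choice[y yP] : forall t, exists y : simplex R X, forall n, 0 <= t ->
    approx k t n @[k --> \oo] --> y n by exists y => t n; exact: yP.
move=> t; have [/approx_cvg[y yP]|t0] := leP 0 t; first by exists y.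
by exists z => n.
Qed.

Section flow.
Variable y : R -> simplex R X.
Hypothesis approx_y : forall t n, 0 <= t -> approx k t n @[k --> \oo] --> y t n.

Let approx_dist t : 0 <= t ->
  simplex_dist (approx k t) (y t) @[k --> \oo] --> 0.
Proof.
move=> t0; have : simplex_dist (approx k t) (y t) @[k --> \oo] -->
    \sum_n `|y t n - y t n|.
  apply: cvg_sumr => n.
  by apply: cvg_norm; apply: cvgB; [exact: approx_y|exact: cvg_cst].
by rewrite big1 // => n _; rewrite subrr normr0.
Qed.

Let approx_V t n : 0 <= t -> V (approx k t) n @[k --> \oo] --> V (y t) n.
Proof.
move=> t0; apply/cvgrPdistC_le => e e0.
have H : c * simplex_dist (approx k t) (y t) @[k --> \oo] --> 0.
  have : c * simplex_dist (approx k t) (y t) @[k --> \oo] --> c * 0.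
    by apply: cvgM; [exact: cvg_cst|exact: approx_dist].
  by rewrite mulr0.
have : \forall k \near \oo, c * simplex_dist (approx k t) (y t) <= e.
  exact: (cvgr_le _ H).
by apply: filterS => k; exact: le_trans.
Qed.

Let gap k s t : R := (steps k t - steps k s)%:R * hk k.

Let gap_cvg s t : 0 <= s <= t -> gap k s t @[k --> \oo] --> t - s.
Proof.
move=> /andP[s0 st]; apply/cvgrPdistC_le => e e0.
have : \forall k \near \oo, hk k <= e by exact: (cvgr_le _ hk_cvg0).
apply: filterS => k; apply: le_trans.
have /andP[] := steps_itv k s0; have /andP[] := steps_itv k (le_trans s0 st).
have le_steps : (steps k s <= steps k t)%N.
  by apply: le_truncn; rewrite ler_pM2r ?invr_gt0.
rewrite /gap natrB // mulrBl ler_norml; lra.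
Qed.

Let approxE k s t : 0 <= s <= t ->
  approx k t = iter (steps k t - steps k s) (euler (hk k)) (approx k s).
Proof.
move=> /andP[s0 st]; rewrite /approx -iterD subnK //.
by apply: le_truncn; rewrite ler_pM2r ?invr_gt0.
Qed.

Let flow_lipschitz_le s t : 0 <= s <= t ->
  simplex_dist (y t) (y s) <= B * (t - s).
Proof.
move=> st; have /andP[s0 sle] := st; have t0 := le_trans s0 sle.
have L : simplex_dist (approx k t) (approx k s) @[k --> \oo] -->
    simplex_dist (y t) (y s).
  by apply: cvg_sumr => n; apply: cvg_norm; apply: cvgB; exact: approx_y.
have G : B * gap k s t @[k --> \oo] --> B * (t - s).
  by apply: cvgM; [exact: cvg_cst|exact: gap_cvg].
apply: ler_cvg_to L G _; apply: nearW => k; rewrite (approxE k st) mulrC.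
exact: iter_euler_drift.
Qed.

Lemma flow_lipschitz s t : 0 <= s -> 0 <= t ->
  simplex_dist (y s) (y t) <= B * `|s - t|.
Proof.
move=> s0 t0; have [st|ts] := leP s t.
  by rewrite dist_sym distrC ger0_norm ?subr_ge0 // flow_lipschitz_le ?s0.
by rewrite ger0_norm ?subr_ge0 ?(ltW ts) // flow_lipschitz_le // t0 ltW.
Qed.

Let flow_linear s t n : 0 <= s <= t ->
  `|y t n - y s n - (t - s) * V (y s) n| <= B ^+ 2 * (t - s) ^+ 2.
Proof.
move=> st; have /andP[s0 sle] := st; have t0 := le_trans s0 sle.
have L : `|approx k t n - approx k s n - gap k s t * V (approx k s) n|
    @[k --> \oo] --> `|y t n - y s n - (t - s) * V (y s) n|.
  apply: cvg_norm; apply: cvgB; first by apply: cvgB; exact: approx_y.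
  by apply: cvgM; [exact: gap_cvg|exact: approx_V].
have G : B ^+ 2 * gap k s t ^+ 2 @[k --> \oo] --> B ^+ 2 * (t - s) ^+ 2.
  apply: cvgM; first exact: cvg_cst.
  by rewrite !expr2; apply: cvgM; exact: gap_cvg.
apply: ler_cvg_to L G _; apply: nearW => k; rewrite (approxE k st).
apply: le_trans
  (iter_euler_linear (approx k s) (steps k t - steps k s) (hk_le k)).
set x := iter _ _ _.
exact: (term_le_sum (F := fun m =>
  `|x m - approx k s m - gap k s t * V (approx k s) m|)).
Qed.

(** Both sides follow from the tangent estimate: on the right directly, on the
left from the tangent at the earlier time and the Lipschitz bounds. *)
Lemma flow_derive t n : 0 <= t ->
  is_derive_nonneg (fun s => mass (y s) n) t (V (y t) n).
Proof.
move=> t0; pose D := 2 * B ^+ 2 + 1.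
have D0 : 0 < D by rewrite ltr_wpDl // mulr_ge0 // exprn_ge0.
have key s : 0 <= s ->
    `|y s n - y t n - (s - t) * V (y t) n| <= D * (s - t) ^+ 2.
  move=> s0; have e0 : 0 <= (s - t) ^+ 2 by exact: sqr_ge0.
  have [ts|/ltW st] := leP t s.
    apply: le_trans (flow_linear n _) _; first by rewrite t0.
    by rewrite ler_wpM2r // /D; have := sqr_ge0 B; lra.
  have -> : y s n - y t n - (s - t) * V (y t) n =
      - (y t n - y s n - (t - s) * V (y s) n) +
      (t - s) * (V (y t) n - V (y s) n) by ring.
  apply: le_trans (ler_normD _ _) _; rewrite normrN.
  apply: le_trans (_ : B ^+ 2 * (t - s) ^+ 2 +
    (t - s) * (B * (B * (t - s))) <= _).
    apply: lerD; first by apply: flow_linear; rewrite s0.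
    rewrite normrM ger0_norm ?subr_ge0 // ler_wpM2l ?subr_ge0 //.
    apply: le_trans (_ : \sum_m `|V (y t) m - V (y s) m| <= _).
      exact: (term_le_sum (F := fun m => `|V (y t) m - V (y s) m|)).
    apply: le_trans (V_lip1 _ _) _; rewrite ler_wpM2l //.
    by apply: flow_lipschitz_le; rewrite s0.
  by rewrite -subr_ge0 (_ : _ - _ = (s - t) ^+ 2) // /D; ring.
apply/cvgrPdistC_le => e e0.
have near_t : \forall s \near t, `|s - t| <= e / D.
  by apply/nbhs_ballP; exists (e / D); [exact: divr_gt0|
    move=> s; rewrite /ball /= distrC => /ltW].
suff : \forall s \near t, s != t -> 0 <= s ->
    `|(y s n - y t n) / (s - t) - V (y t) n| <= e by [].
apply: filterS near_t => s st s_neq s0.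
have st0 : s - t != 0 by rewrite subr_eq0.
have -> : (y s n - y t n) / (s - t) - V (y t) n =
    (y s n - y t n - (s - t) * V (y t) n) / (s - t) by field.
rewrite normrM normfV ler_pdivrMr ?normr_gt0 //; apply: le_trans (key s s0) _.
rewrite -real_normK ?num_real // expr2 mulrA ler_wpM2r //.
by rewrite -ler_pdivlMl // mulrC.
Qed.

End flow.

(** Existence of a solution that stays in the simplex, as the limit of the Euler
schemes of steps [h0 / 2^k]. *)
Lemma ode_exists : exists y : cadlag (simplex R X), y 0 = z /\
  forall t n, 0 <= t -> is_derive_nonneg (fun s => mass (y s) n) t (V (y t) n).
Proof.
have [y yP] := flow_exists.
have near_dist t e : 0 <= t -> 0 < e ->
    \forall s \near t, 0 <= s -> simplex_dist (y t) (y s) < e.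
  move=> t0 e0; have B1 : 0 < B + 1 by rewrite ltr_wpDl.
  apply/nbhs_ballP; exists (e / (B + 1)); first exact: divr_gt0.
  move=> s; rewrite /ball /= ltr_pdivlMr // => st s0.
  apply: le_lt_trans (flow_lipschitz yP t0 s0) _; apply: le_lt_trans st.
  by rewrite mulrC ler_wpM2l // lerDl.
have right t : 0 <= t -> y s @[s --> t^'+] --> y t.
  move=> t0; apply/cvg_ballP => e e0.
  suff : \forall s \near t, t < s -> ball (y t) e (y s) by [].
  apply: filterS (near_dist t e t0 e0) => s H ts; rewrite ballEmdist.
  by apply: H; exact: ltW (le_lt_trans t0 ts).
have left t : 0 < t -> exists l : simplex R X, y s @[s --> t^'-] --> l.
  move=> t0; exists (y t); apply/cvg_ballP => e e0.
  suff : \forall s \near t, s < t -> ball (y t) e (y s) by [].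
  near=> s => _; rewrite ballEmdist /=.
  have s0 : 0 <= s by apply: ltW; near: s; exact: lt_nbhsr.
  by move: s0; near: s; exact: near_dist (ltW t0) e0.
exists (Cadlag right left); split; last by move=> t n; exact: flow_derive.
apply/val_inj/ffunP => n; apply: (cvg_unique (@Rhausdorff R) (yP 0 n (lexx 0))).
have -> : (fun k => approx k 0 n) = fun=> z n; last exact: cvg_cst.
by apply/funext => k; rewrite /approx /steps mul0r truncn0.
Unshelve. all: by end_near. Qed.
End ode_on_simplex.

(** * The generator of the empirical process *)

Section generator.
Context {R : realType} {K C : nat} {A : 'I_K -> nat}.
Context {lambda gamma mu : 'I_K -> R}.
Hypothesis lambda_ge0 : forall k, 0 <= lambda k.
Hypothesis gamma_ge0 : forall k, 0 <= gamma k.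
Hypothesis mu_ge0 : forall k, 0 <= mu k.
Local Notation X := (config C A).
Local Notation V := (V lambda gamma mu).
Variable N : nat.
Hypothesis N_ge2 : (2 <= N)%N.
Local Notation S := (@empirical_states R K C A N).
Local Notation rate := (rate lambda gamma mu N).
Implicit Types (x y u : simplex R X) (n m : X) (v : {ffun X -> R}).

Let N_gt0 : 0 < N%:R :> R. Proof. by rewrite ltr0n ltnW. Qed.
Let N_neq0 : N%:R != 0 :> R. Proof. by rewrite gt_eqF. Qed.
Let N1_gt0 : 0 < N%:R - 1 :> R. Proof. by rewrite subr_gt0 ltr1n. Qed.

(** The masses of an empirical distribution are multiples of [1 / N] by integers
between 0 and [N]. *)
Lemma finite_empirical_states : finite_set S.
Proof.
have [[x0 _]|S0] := pselect (S !=set0); last first.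
  rewrite (_ : S = set0) //; apply/seteqP; split => // x Sx.
  by case: S0; exists x.
pose f (c : {ffun X -> 'I_N.+1}) : simplex R X :=
  insubd x0 [ffun n => (c n)%:R / N%:R].
apply: (@sub_finite_set _ _ (f @` setT)); last exact/finite_image/finite_finset.
move=> x Sx; have /choice[c cE] := Sx.
have cN n : (c n < N.+1)%N.
  by rewrite ltnS -(ler_nat R) -cE -[leRHS]mulr1 ler_pM2l // simplex_le1.
exists [ffun n => Ordinal (cN n)] => //; apply: val_inj.
have E : [ffun n => ([ffun n => Ordinal (cN n)] n)%:R / N%:R] = mass x.
  apply/ffunP => n; rewrite !ffunE /= -cE mulrC mulKf //.
by rewrite /f val_insubd E ifT //; exact: (valP x).
Qed.

Let count x n : S x -> exists j : nat, N%:R * x n = j%:R. Proof. exact. Qed.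

(** Every transition of positive rate consists of one such move, or of two in
succession. *)
Lemma move_one x n m : S x -> x n != 0 ->
  exists2 u, S u & mass u = mass x + N%:R^-1 *: (unitv R m - unitv R n).
Proof.
move=> Sx xn0; have /choice[c cE] := Sx.
set f : {ffun X -> R} := mass x + _.
have cn : (0 < c n)%N.
  by rewrite lt0n -(eqr_nat R) -cE mulf_neq0.
have fE a : N%:R * f a = (c a - (a == n) + (a == m))%:R.
  have ca : ((a == n) <= c a)%N by case: eqP => // ->.
  rewrite natrD natrB // -cE /f !ffunE /GRing.scale /= mulrDr mulVKf //.
  by ring.
have [||u uE] := @simplexP R X f.
- by move=> a; rewrite -(pmulr_rge0 _ N_gt0) fE.
- rewrite /f; under eq_bigr do rewrite !ffunE /GRing.scale /=.
  rewrite big_split /= simplex_sum -mulr_sumr sumrB.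
  have one b : \sum_(a : X) (a == b)%:R = 1 :> R.
    by rewrite (bigD1 b) //= eqxx big1 ?addr0 // => a /negbTE ->.
  by rewrite !one subrr mulr0 addr0.
- by exists u => // a; rewrite uE fE; exists (c a - (a == n) + (a == m))%N.
Qed.

(** The number of ordered pairs of distinct nodes in the states [n] and [m],
divided by [N]. *)
Lemma pair_rate_ge0 x n m : S x -> 0 <= x n * (N%:R * x m - (m == n)%:R).
Proof.
move=> Sx; have [->|xn0] := eqVneq (x n) 0; first by rewrite mul0r.
rewrite mulr_ge0 ?simplex_ge0 // subr_ge0.
case: eqP => [->|_]; last by rewrite mulr_ge0 // simplex_ge0.
have [j jE] := count n Sx; rewrite jE ler1n lt0n -(eqr_nat R) -jE.
by rewrite mulf_neq0.
Qed.

Let transfer_rate_ge0 x n m k : S x ->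
  0 <= gamma k * N%:R / (N%:R - 1) * (pop n k)%:R * x n *
         (N%:R * x m - (m == n)%:R).
Proof.
move=> Sx; rewrite -[_ * x n * _]mulrA.
apply: mulr_ge0; last exact: pair_rate_ge0.
by rewrite !mulr_ge0 // invr_ge0 ltW.
Qed.

Lemma rate_ge0 x u : S x -> 0 <= rate x u.
Proof.
move=> Sx; rewrite /rate !addr_ge0 //; apply: sumr_ge0 => n _.
- by apply: sumr_ge0 => k _; rewrite !mulr_ge0 // simplex_ge0.
- by apply: sumr_ge0 => k _; rewrite !mulr_ge0 // simplex_ge0.
- apply: sumr_ge0 => m _; apply: sumr_ge0 => k _.
  by rewrite mulr_ge0 // transfer_rate_ge0.
Qed.

(** At most one state is reached by a given displacement, and exactly one if the
rate is not zero. *)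
Lemma jump_sum x v (r : R) (G : {ffun X -> R} -> R) :
  (r != 0 -> exists2 u, S u & mass u = mass x + N%:R^-1 *: v) ->
  \sum_(u <- fset_set S) r * (goes N x u v)%:R * G (mass u) =
  r * G (mass x + N%:R^-1 *: v).
Proof.
have [->|r0 /(_ isT)[u Su uE]] := eqVneq r 0.
  by move=> _; rewrite mul0r big1 // => u _; rewrite !mul0r.
have uS : u \in (fset_set S : seq (simplex R X)).
  by rewrite in_fset_set ?mem_set //; exact: finite_empirical_states.
rewrite (bigD1_seq u) //=; last exact: fset_uniq.
rewrite /goes -uE eqxx mulr1 big1 ?addr0 // => u' u'u.
case: eqP => [/val_inj E|_]; last by rewrite mulr0 mul0r.
by rewrite E eqxx in u'u.
Qed.

Lemma departure_target x n k : S x -> (pop n k)%:R * x n != 0 ->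
  exists2 u, S u & mass u = mass x + N%:R^-1 *: departure_jump R n k.
Proof.
rewrite mulf_eq0 negb_or pnatr_eq0 -lt0n => Sx /andP[/decr_neq_None + xn].
by rewrite /departure_jump; case: decr => // m _; exact: move_one.
Qed.

Lemma arrival_target x n k : S x -> x n * (incr n k != None)%:R != 0 ->
  exists2 u, S u & mass u = mass x + N%:R^-1 *: arrival_jump R n k.
Proof.
rewrite mulf_eq0 negb_or /arrival_jump; case: incr => [m|] Sx /andP[xn] /=.
  by move=> _; exact: move_one.
by rewrite eqxx.
Qed.

(** A node is still in the state [m] after the departure: if [m = n], at least
two nodes are in this state. *)
Lemma transfer_target x n m k : S x ->
  (pop n k)%:R * x n * (N%:R * x m - (m == n)%:R) != 0 ->
  exists2 u, S u & mass u = mass x + N%:R^-1 *: transfer_jump R n m k.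
Proof.
move=> Sx; rewrite mulf_eq0 negb_or => /andP[xn xm].
have [u Su uE] := departure_target Sx xn.
rewrite /transfer_jump; case: ifP => im; last by exists u; rewrite // addr0.
have um : u m * (incr m k != None)%:R != 0.
  rewrite im mulr1.
  suff : 0 < N%:R * u m by rewrite pmulr_rgt0 // => /lt0r_neq0.
  move: xn; rewrite mulf_eq0 negb_or => /andP[_ xn].
  have xm_gt0 : 0 < N%:R * x m - (m == n)%:R.
    rewrite lt_neqAle eq_sym xm; have := pair_rate_ge0 n m Sx.
    by rewrite pmulr_rge0 // lt_neqAle eq_sym xn simplex_ge0.
  apply: lt_le_trans xm_gt0 _; rewrite uE !ffunE.
  rewrite /GRing.scale /= mulrDr mulVKf // lerD2l /departure_jump.
  case: decr => [a|] /=; rewrite !ffunE; last by rewrite add0r.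
  by rewrite -[leLHS]add0r lerD2r.
have [u' Su' u'E] := arrival_target Su um.
by exists u' => //; rewrite u'E uE -addrA -scalerDr.
Qed.

(** The transitions of positive rate lead to states of the process, so that the
sum over target states can be regrouped by transitions. *)
Lemma rate_sum x (G : {ffun X -> R} -> R) : S x ->
  \sum_(u <- fset_set S) rate x u * G (mass u) =
  \sum_n \sum_k lambda k * N%:R * x n * (incr n k != None)%:R *
    G (mass x + N%:R^-1 *: arrival_jump R n k) +
  \sum_n \sum_k mu k * (pop n k)%:R * N%:R * x n *
    G (mass x + N%:R^-1 *: departure_jump R n k) +
  \sum_n \sum_m \sum_k
    gamma k * N%:R / (N%:R - 1) * (pop n k)%:R * x n *
       (N%:R * x m - (m == n)%:R) *
    G (mass x + N%:R^-1 *: transfer_jump R n m k).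
Proof.
move=> Sx; rewrite /rate.
under eq_bigr do rewrite !mulrDl; rewrite !big_split /=.
congr (_ + _ + _).
- under eq_bigr do rewrite mulr_suml.
  rewrite exchange_big; apply: eq_bigr => n _.
  under eq_bigr do rewrite mulr_suml.
  rewrite exchange_big; apply: eq_bigr => k _.
  apply: jump_sum => r0; apply: arrival_target => //.
  by apply: contraNN r0; rewrite -mulrA => /eqP ->; rewrite mulr0.
- under eq_bigr do rewrite mulr_suml.
  rewrite exchange_big; apply: eq_bigr => n _.
  under eq_bigr do rewrite mulr_suml.
  rewrite exchange_big; apply: eq_bigr => k _.
  apply: jump_sum => r0; apply: departure_target => //; apply: contraNN r0.
  move=> /eqP E; have -> : mu k * (pop n k)%:R * N%:R * x n =
      mu k * N%:R * ((pop n k)%:R * x n) by ring.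
  by rewrite E mulr0.
- under eq_bigr do rewrite mulr_suml.
  rewrite exchange_big; apply: eq_bigr => n _.
  under eq_bigr do rewrite mulr_suml.
  rewrite exchange_big; apply: eq_bigr => m _.
  under eq_bigr do rewrite mulr_suml.
  rewrite exchange_big; apply: eq_bigr => k _.
  apply: jump_sum => r0; apply: transfer_target => //; apply: contraNN r0.
  by move=> /eqP E; rewrite -!mulrA in E *; rewrite E !mulr0.
Qed.

Lemma dotp_unitv g m : dotp g (unitv R m) = g m.
Proof.
rewrite /dotp (bigD1 m) //= ffunE eqxx mulr1 big1 ?addr0 // => n nm.
by rewrite ffunE (negbTE nm) mulr0.
Qed.

Lemma dotp_oapp_unitv g (o : option X) :
  dotp g (oapp (unitv R (A:=A)) 0 o) = oapp g 0 o.
Proof.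
case: o => [m|] /=; first exact: dotp_unitv.
by rewrite /dotp big1 // => n _; rewrite ffunE mulr0.
Qed.

Lemma dotp_departure g n k :
  dotp g (departure_jump R n k) = departure_diff g k n.
Proof. by rewrite dotpD dotpN dotp_oapp_unitv dotp_unitv. Qed.

Lemma dotp_arrival g n k :
  (incr n k != None)%:R * dotp g (arrival_jump R n k) = arrival_diff g k n.
Proof.
rewrite dotpD dotpN dotp_oapp_unitv dotp_unitv /arrival_diff.
by case: incr => [m|] /=; rewrite ?mul1r ?mulr1 // mul0r mulr0 subrr.
Qed.

Lemma dotp_transfer g n m k :
  dotp g (transfer_jump R n m k) = departure_diff g k n + arrival_diff g k m.
Proof.
rewrite dotpD dotp_departure -dotp_arrival; congr (_ + _).
case: ifP => _; first by rewrite mul1r.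
by rewrite mul0r /dotp big1 // => a _; rewrite ffunE mulr0.
Qed.

Lemma sqnorm_oapp_unitv (o : option X) :
  sqnorm (oapp (unitv R (A:=A)) 0 o) <= 1.
Proof.
case: o => [m|] /=.
  rewrite /sqnorm (bigD1 m) //= ffunE eqxx expr1n big1 ?addr0 // => n nm.
  by rewrite ffunE (negbTE nm) expr0n.
by rewrite /sqnorm big1 // => n _; rewrite ffunE expr0n.
Qed.

Lemma sqnorm_unit_jump (o : option X) n :
  sqnorm (oapp (unitv R (A:=A)) 0 o - unitv R n) <= 4.
Proof.
apply: le_trans (sqnormD _ _) _.
have -> : sqnorm (- unitv R n) = sqnorm (unitv R n).
  by apply: eq_bigr => m _; rewrite !ffunE sqrrN.
by have := sqnorm_oapp_unitv o; have := sqnorm_oapp_unitv (Some n) => /=; lra.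
Qed.

Lemma sqnorm_transfer n m k : sqnorm (transfer_jump R n m k) <= 16.
Proof.
apply: le_trans (sqnormD _ _) _.
have := sqnorm_unit_jump (decr n k) n; rewrite -/(departure_jump R n k).
suff : sqnorm (if incr m k != None then arrival_jump R m k else 0) <= 4 by lra.
case: ifP => _; first exact: sqnorm_unit_jump.
by rewrite /sqnorm big1 // => a _; rewrite ffunE expr0n.
Qed.

Lemma sqdist_jump x y v :
  sqnorm (mass x + N%:R^-1 *: v - mass y) - sqnorm (mass x - mass y) =
  2 / N%:R * dotp (mass x - mass y) v + N%:R^-2 * sqnorm v.
Proof.
rewrite /sqnorm /dotp -sumrB !mulr_sumr -big_split; apply: eq_bigr => n _ /=.
by rewrite !ffunE /GRing.scale /=; field.
Qed.

Section drift.
Variables (x y : simplex R X).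
Hypothesis Sx : S x.
Let g : X -> R := mass x - mass y.
Let U k := \sum_m x m * arrival_diff g k m.
Let D k := \sum_m (pop m k)%:R * x m * departure_diff g k m.
Let G (u : {ffun X -> R}) := sqnorm (u - mass y) - sqnorm (mass x - mass y).

(* The increment of the square distance is linear in the displacement up to
   O(1/N^2). The total rate being O(N), the quadratic part contributes O(1/N) to
   the generator: the terms in 4, 4 and one half of 32 in the three parts
   below. *)
Let jump_le v b : sqnorm v <= b ->
  G (mass x + N%:R^-1 *: v) <= 2 / N%:R * dotp g v + b / N%:R ^+ 2.
Proof.
by move=> vb; rewrite /G sqdist_jump lerD2l mulrC ler_wpM2r.
Qed.

Let arrival_part k :
  \sum_n lambda k * N%:R * x n * (incr n k != None)%:R *
    G (mass x + N%:R^-1 *: arrival_jump R n k) <=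
  2 * (lambda k * U k) + 4 * lambda k / N%:R.
Proof.
have -> : 2 * (lambda k * U k) + 4 * lambda k / N%:R = \sum_n
    (2 * (lambda k * (x n * arrival_diff g k n)) + 4 * lambda k / N%:R * x n).
  by rewrite big_split /= -!mulr_sumr simplex_sum mulr1.
apply: ler_sum => n _; rewrite -dotp_arrival.
have i1 : (incr n k != None)%:R <= 1 :> R by case: (_ != _).
have r0 : 0 <= lambda k * N%:R * x n by rewrite !mulr_ge0 // simplex_ge0.
have := jump_le (sqnorm_unit_jump (incr n k) n); rewrite -/(arrival_jump R n k).
set d := dotp _ _; set h := G _; set i := _%:R in i1 * => hle.
apply: le_trans (ler_wpM2l _ hle) _; first by rewrite mulr_ge0.
rewrite -subr_ge0
  (_ : _ - _ = 4 * (lambda k * N%:R * x n) * (1 - i) / N%:R ^+ 2).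
  by rewrite !mulr_ge0 ?subr_ge0 ?simplex_ge0.
by field.
Qed.

Let departure_part k :
  \sum_n mu k * (pop n k)%:R * N%:R * x n *
    G (mass x + N%:R^-1 *: departure_jump R n k) <=
  2 * (mu k * D k) + 4 * (mu k * C%:R) / N%:R.
Proof.
apply: le_trans (_ : 2 * (mu k * D k) + 4 * (mu k * mean_pop k x) / N%:R <= _);
  last first.
  rewrite lerD2l ler_wpM2r ?invr_ge0 // ler_wpM2l // ler_wpM2l //.
  exact: mean_pop_le.
have -> : 2 * (mu k * D k) + 4 * (mu k * mean_pop k x) / N%:R = \sum_n
    (2 * (mu k * ((pop n k)%:R * x n * departure_diff g k n)) +
     4 * (mu k * ((pop n k)%:R * x n)) / N%:R).
  by rewrite big_split /= -!mulr_sumr -mulr_suml -!mulr_sumr.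
apply: ler_sum => n _; rewrite -dotp_departure.
have r0 : 0 <= mu k * (pop n k)%:R * N%:R * x n.
  by rewrite !mulr_ge0 // simplex_ge0.
have := jump_le (sqnorm_unit_jump (decr n k) n).
rewrite -/(departure_jump R n k).
move=> hle; apply: le_trans (ler_wpM2l r0 hle) _.
by rewrite le_eqVlt; apply/orP; left; apply/eqP; field.
Qed.

Let arrival_diff_le2 k n : `|arrival_diff g k n| <= 2.
Proof.
have g1 m : `|g m| <= 1.
  rewrite /g !ffunE ler_norml; have := simplex_ge0 x m; have := simplex_ge0 y m.
  by have := simplex_le1 x m; have := simplex_le1 y m; lra.
rewrite /arrival_diff; case: incr => [m|] /=;
  last by rewrite mulr0 subrr normr0.
rewrite mulr1; apply: le_trans (ler_normB _ _) _.
by have := g1 m; have := g1 n; lra.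
Qed.

Let U_le2 k : `|U k| <= 2.
Proof.
apply: le_trans (ler_norm_sum _ _ _) _.
have -> : 2 = \sum_m x m * 2 :> R by rewrite -mulr_suml simplex_sum mul1r.
apply: ler_sum => m _; rewrite normrM ger0_norm ?simplex_ge0 //.
by rewrite ler_wpM2l // simplex_ge0.
Qed.

(* Arrivals from other nodes are the only nonlinear part. Replacing the state of
   a node other than the sender by that of an arbitrary node gives the factor
   [mean_pop k x * U k] up to an error O(1/N), as [1 / (N - 1) <= 2 / N]; this
   error is the other half of 32. *)
Let transfer_part k :
  \sum_n \sum_m gamma k * N%:R / (N%:R - 1) * (pop n k)%:R * x n *
       (N%:R * x m - (m == n)%:R) *
    G (mass x + N%:R^-1 *: transfer_jump R n m k) <=
  2 * (gamma k * (D k + mean_pop k x * U k)) + 32 * (gamma k * C%:R) / N%:R.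
Proof.
pose r := gamma k * N%:R / (N%:R - 1).
pose w n m : R := (pop n k)%:R * x n * (N%:R * x m - (m == n)%:R).
have w0 n m : 0 <= w n m by rewrite /w -mulrA mulr_ge0 // pair_rate_ge0.
have r0 : 0 <= r by rewrite !mulr_ge0 // invr_ge0 ltW.
pose Q := \sum_n (pop n k)%:R * x n * arrival_diff g k n.
have sum_delta (h : X -> R) n : \sum_m (m == n)%:R * h m = h n.
  rewrite (bigD1 n) //= eqxx mul1r big1 ?addr0 // => m /negbTE ->.
  by rewrite mul0r.
have w1 n : \sum_m w n m = (pop n k)%:R * x n * (N%:R - 1).
  rewrite -mulr_sumr sumrB -mulr_sumr simplex_sum mulr1; congr (_ * (_ - _)).
  by have := sum_delta (fun=> 1) n; under eq_bigr do rewrite mulr1.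
have w2 n : \sum_m w n m * arrival_diff g k m =
    (pop n k)%:R * x n * (N%:R * U k - arrival_diff g k n).
  rewrite -(sum_delta (arrival_diff g k) n) mulr_sumr -sumrB mulr_sumr.
  by apply: eq_bigr => m _; rewrite /w; ring.
apply: le_trans (_ : \sum_n \sum_m r * (w n m *
    (2 / N%:R * (departure_diff g k n + arrival_diff g k m) +
     16 / N%:R ^+ 2)) <= _).
  apply: ler_sum => n _; apply: ler_sum => m _; rewrite -dotp_transfer.
  rewrite [leLHS](_ : _ =
    r * (w n m * G (mass x + N%:R^-1 *: transfer_jump R n m k))).
    by do 2 (rewrite ler_wpM2l //); apply/jump_le/sqnorm_transfer.
  by rewrite /r /w; ring.
have -> : \sum_n \sum_m r * (w n m *
    (2 / N%:R * (departure_diff g k n + arrival_diff g k m) + 16 / N%:R ^+ 2)) =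
    r * (2 / N%:R * ((N%:R - 1) * D k + N%:R * mean_pop k x * U k - Q) +
      16 / N%:R ^+ 2 * ((N%:R - 1) * mean_pop k x)).
  have -> : r * (2 / N%:R * ((N%:R - 1) * D k + N%:R * mean_pop k x * U k - Q) +
      16 / N%:R ^+ 2 * ((N%:R - 1) * mean_pop k x)) =
    \sum_n r *
      (2 / N%:R * ((N%:R - 1) * ((pop n k)%:R * x n * departure_diff g k n) +
       (pop n k)%:R * x n * (N%:R * U k - arrival_diff g k n)) +
       16 / N%:R ^+ 2 * ((N%:R - 1) * ((pop n k)%:R * x n))).
    rewrite -mulr_sumr big_split /= -!mulr_sumr big_split /= -!mulr_sumr.
    congr (r * (_ * _ + _)); rewrite -addrA; congr (_ + _).
    rewrite /Q /mean_pop mulr_sumr mulr_suml -sumrB.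
    by apply: eq_bigr => n _; ring.
  apply: eq_bigr => n _; rewrite -w2 -mulr_sumr; congr (r * _).
  rewrite (_ : (N%:R - 1) * ((pop n k)%:R * x n * departure_diff g k n) =
    (\sum_m w n m) * departure_diff g k n); last by rewrite w1; ring.
  rewrite (_ : (N%:R - 1) * ((pop n k)%:R * x n) = \sum_m w n m);
    last by rewrite w1; ring.
  rewrite mulr_suml -big_split /= !mulr_sumr -big_split /=.
  by apply: eq_bigr => m _; ring.
have m0 := mean_pop_ge0 k x; have mC := mean_pop_le k x.
have Q2 : `|Q| <= mean_pop k x * 2.
  apply: le_trans (ler_norm_sum _ _ _) _; rewrite /mean_pop mulr_suml.
  have px0 n : 0 <= (pop n k)%:R * x n by rewrite mulr_ge0 // simplex_ge0.
  by apply: ler_sum => n _; rewrite normrM (ger0_norm (px0 n)) ler_wpM2l.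
have -> : r * (2 / N%:R * ((N%:R - 1) * D k + N%:R * mean_pop k x * U k - Q) +
      16 / N%:R ^+ 2 * ((N%:R - 1) * mean_pop k x)) =
    2 * (gamma k * (D k + mean_pop k x * U k)) +
    (2 * (gamma k * (mean_pop k x * U k - Q)) / (N%:R - 1) +
     16 * (gamma k * mean_pop k x) / N%:R).
  by rewrite /r; field; rewrite !gt_eqF.
rewrite lerD2l.
have -> : 32 * (gamma k * C%:R) / N%:R =
  16 * (gamma k * C%:R) / N%:R + 16 * (gamma k * C%:R) / N%:R by ring.
apply: lerD; last by rewrite ler_wpM2r ?invr_ge0 // !ler_wpM2l.
have N1 : (N%:R - 1)^-1 <= 2 / N%:R :> R.
  rewrite ler_pdivlMr // ler_pdivrMl //.
  have N2 : 2 <= N%:R :> R by rewrite ler_nat.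
  lra.
have UQ : mean_pop k x * U k - Q <= 4 * C%:R.
  have := U_le2 k; move: Q2; rewrite !ler_norml => /andP[Q1 _] /andP[_ U2].
  have := ler_wpM2l m0 U2; lra.
have gC : 0 <= gamma k * C%:R by rewrite mulr_ge0.
apply: le_trans (_ : 2 * (gamma k * (4 * C%:R)) / (N%:R - 1) <= _).
  by rewrite ler_wpM2r ?invr_ge0 ?(ltW N1_gt0) // !ler_wpM2l.
have -> : 16 * (gamma k * C%:R) / N%:R =
  2 * (gamma k * (4 * C%:R)) * (2 / N%:R).
  by ring.
by rewrite ler_wpM2l // !mulr_ge0.
Qed.

(** [V] is the drift of the empirical distribution up to an error O(1/N), and
the fluctuations contribute another O(1/N). *)
Lemma generator_sqdist :
  \sum_(u <- fset_set S) rate x u *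
    (sqnorm (mass u - mass y) - sqnorm (mass x - mass y)) <=
  2 * \sum_n (x n - y n) * V x n +
  (\sum_k (lambda k + gamma k + mu k) * (32 * C.+1)%:R) / N%:R.
Proof.
rewrite (@rate_sum x G) //.
have -> : \sum_n (x n - y n) * V x n = \sum_n g n * V x n.
  by apply: eq_bigr => n _; rewrite /g !ffunE.
rewrite V_weak exchange_big [X in _ + X + _]exchange_big /=.
have -> : \sum_n \sum_m \sum_k gamma k * N%:R / (N%:R - 1) * (pop n k)%:R *
    x n * (N%:R * x m - (m == n)%:R) *
    G (mass x + N%:R^-1 *: transfer_jump R n m k) =
  \sum_k \sum_n \sum_m gamma k * N%:R / (N%:R - 1) * (pop n k)%:R *
    x n * (N%:R * x m - (m == n)%:R) *
    G (mass x + N%:R^-1 *: transfer_jump R n m k).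
  by under eq_bigr do rewrite exchange_big; rewrite exchange_big.
rewrite -!big_split /= mulr_suml mulr_sumr -big_split /=.
apply: ler_sum => k _.
apply: le_trans (lerD (lerD (arrival_part k) (departure_part k))
  (transfer_part k)) _.
rewrite -/(U k) -/(D k) -subr_ge0 natrM -(natr1 C).
rewrite (_ : _ - _ = (28 * lambda k + 32 * (lambda k * C%:R) + 32 * gamma k +
  32 * mu k + 28 * (mu k * C%:R)) / N%:R); last by field.
have := lambda_ge0 k; have := gamma_ge0 k; have := mu_ge0 k => m0 g0 l0.
have lC : 0 <= lambda k * C%:R by rewrite mulr_ge0.
have mC : 0 <= mu k * C%:R by rewrite mulr_ge0.
by rewrite divr_ge0 //; lra.
Qed.
End drift.
End generator.

(** * Expectations *)

Section expectations.
Context {d : measure_display} {T : measurableType d} {R : realType}.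
Implicit Types (P : probability T R).

(** The integral of an arbitrary function is defined through simple functions
below its positive and negative parts, hence is monotone even when the
functions are not measurable. *)
Lemma le_expectation P (F G : T -> R) : (forall w, F w <= G w) ->
  ('E_P[F] <= 'E_P[G])%E.
Proof.
move=> FG; rewrite unlock.
have FGE : {in setT, forall w, (fun w => (F w)%:E) \_ setT w <=
    (fun w => (G w)%:E) \_ setT w}%E.
  by move=> w _; rewrite !patch_setT lee_fin.
apply: leeB; apply: ereal_sup_le => _ [h hF <-]; exists h => // x;
  apply: le_trans (hF x) _.
- by apply: (funepos_le FGE); rewrite in_setT.
- by apply: (funeneg_le FGE); rewrite in_setT.
Qed.

Lemma expectation_simple P (I : Type) (r : seq I) (c : I -> R)
    (B : I -> set T) : (forall i, measurable (B i)) ->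
  ('E_P[fun w => (\sum_(i <- r) c i * \1_(B i) w)%R])%E =
  (\sum_(i <- r) c i * fine (P (B i)))%:E.
Proof.
move=> mB; have intB i : P.-integrable setT (fun w => (\1_(B i) w)%:E).
  exact: integrable_indic.
rewrite unlock -sumEFin; under eq_integral do rewrite -sumEFin.
rewrite integral_sum //; last first.
  by move=> i; apply: (@integrableZl _ _ _ P _ measurableT (c i) _ (intB i)).
apply: eq_bigr => i _; under eq_integral do rewrite EFinM.
rewrite integralZl // integral_indic // setIT EFinM fineK //.
exact: fin_num_measure.
Qed.

Lemma expectation_cst_indic P (a b : R) (B : set T) : measurable B ->
  ('E_P[fun w => (a + b * \1_B w)%R])%E = (a + b * fine (P B))%:E.
Proof.
move=> mB.
have := @expectation_simple P bool [:: true; false]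
  (fun i => if i then a else b) (fun i => if i then setT else B).
rewrite !big_cons !big_nil /= probability_setT mulr1 addr0 => <-; last by case.
congr expectation; apply/funext => w.
by rewrite !big_cons !big_nil /= indicT mulr1 addr0.
Qed.

(** For an arbitrary bounded [F]: it suffices to know that [F] is close to [a]
off a measurable set of small probability. *)
Lemma expectation_close P (F : T -> R) (B : set T) (a e M : R) :
  measurable B -> (forall w, `|F w - a| <= 2 * M) ->
  (forall w, ~ B w -> `|F w - a| <= e) -> 0 <= e ->
  ((a - (e + 2 * M * fine (P B)))%:E <= 'E_P[F] <=
   (a + (e + 2 * M * fine (P B)))%:E)%E.
Proof.
move=> mB FM Fe e0.
have key w : `|F w - a| <= e + 2 * M * \1_B w.
  have [Bw|nBw] := pselect (B w).
    by rewrite indicE mem_set // mulr1; apply: le_trans (FM w) _; rewrite lerDr.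
  by rewrite indicE memNset // mulr0 addr0 Fe.
rewrite addrA opprD addrA -!mulNr -!expectation_cst_indic //.
by apply/andP; split; apply: le_expectation => w; have := key w;
  rewrite ler_norml => /andP[]; lra.
Qed.
End expectations.

Lemma expectation_mean_on (R : realType) (E : metricType R) (S : set E)
    (q : E -> E -> R) (d : measure_display) (T : measurableType d)
    (P : probability T R) (Y : T -> cadlag E) (t : R) (f : E -> R) :
  finite_set S -> markov_jump_process S q P Y -> 0 <= t ->
  ('E_P[fun w => f (Y w t)])%E = (mean_on S P Y setT t f)%:E.
Proof.
move=> finS mY t0; rewrite /mean_on; under eq_bigr do rewrite setTI.
rewrite -(@expectation_simple _ _ _ P _ _ f (fun x => [set w | Y w t = x])).
  congr expectation; apply/funext => w.
  have YS : Y w t \in (fset_set S : seq E).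
    by rewrite in_fset_set // mem_set //; exact: (jump_state mY).
  rewrite (bigD1_seq (Y w t)) //=; last exact: fset_uniq.
  rewrite indicE mem_set // mulr1 big1 ?addr0 // => x xY.
  by rewrite indicE memNset ?mulr0 // => /= Yx; rewrite Yx eqxx in xY.
by move=> x; exact: (jump_measurable mY).
Qed.

(** * The mean-field limit *)

Section mean_field_limit.
Context {R : realType} {K C : nat} {A : 'I_K -> nat}.
Context {lambda gamma mu : 'I_K -> R}.
Hypothesis lambda_ge0 : forall k, 0 <= lambda k.
Hypothesis gamma_ge0 : forall k, 0 <= gamma k.
Hypothesis mu_ge0 : forall k, 0 <= mu k.
Local Notation X := (config C A).
Local Notation V := (V lambda gamma mu).
Local Notation c0 := (rate_bound C lambda gamma mu).

(* The discount rate [c] exceeds the one-sided Lipschitz constant of [V] for the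
   square norm by 1: this absorbs [kappa / N] without a division by [c]. *)
Let c : R := 1 + 2 * c0 * #|{: X}|%:R.
Let kappa : R := \sum_k (lambda k + gamma k + mu k) * (32 * C.+1)%:R.

Let c_ge1 : 1 <= c.
Proof. by rewrite lerDl !mulr_ge0 // rate_bound_ge0. Qed.

Let kappa_ge0 : 0 <= kappa.
Proof. by apply: sumr_ge0 => k _; rewrite mulr_ge0 // !addr_ge0. Qed.

Lemma one_sided_lipschitz (x y : simplex R X) :
  2 * \sum_n (x n - y n) * (V x n - V y n) <=
  (c - 1) * sqnorm (mass x - mass y).
Proof.
rewrite /c addrAC subrr add0r -mulrA -!mulrA ler_wpM2l //.
apply: le_trans (_ : c0 * simplex_dist x y ^+ 2 <= _); last first.
  by rewrite ler_wpM2l ?rate_bound_ge0 // simplex_dist_sqnorm.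
rewrite expr2 mulrCA mulr_suml; apply: ler_sum => n _.
apply: le_trans (ler_norm _) _; rewrite normrM ler_wpM2l //.
exact: V_lipschitz.
Qed.

Lemma deriv_sqdist (f g : R -> X -> R) (df dg : X -> R) t :
  (forall n, deriv_within [set s | 0 <= s] (f ^~ n) t (df n)) ->
  (forall n, deriv_within [set s | 0 <= s] (g ^~ n) t (dg n)) ->
  deriv_within [set s | 0 <= s] (fun s => \sum_n (f s n - g s n) ^+ 2) t
    (2 * \sum_n (f t n - g t n) * (df n - dg n)).
Proof.
move=> fd gd; rewrite mulr_sumr; apply: deriv_within_sum => n _.
have -> : 2 * ((f t n - g t n) * (df n - dg n)) =
  (df n - dg n) * (f t n - g t n) + (f t n - g t n) * (df n - dg n) by ring.
have -> : (fun s => (f s n - g s n) ^+ 2) =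
  (fun s => (f s n - g s n) * (f s n - g s n)).
  by apply/funext => s; rewrite expr2.
by apply: deriv_withinM; exact: deriv_withinB.
Qed.

Let ode_deriv z (y : cadlag (simplex R X)) t n :
  ode_solution lambda gamma mu z y -> 0 <= t ->
  deriv_within [set s | 0 <= s] (fun s => mass (y s) n) t (V (y t) n).
Proof. by move=> [_ yd] t0; apply: deriv_within_quotient; exact: yd. Qed.

Let exp_deriv t :
  deriv_within [set s | 0 <= s] (fun s => expR (- c * s)) t
    (- c * expR (- c * t)).
Proof. exact: deriv_within_expR. Qed.

(** The minimum principle on a one-point space says that the square distance
between two solutions, discounted at the rate [c], does not increase. *)
Lemma ode_unique (z : simplex R X) (y y' : cadlag (simplex R X)) :
  ode_solution lambda gamma mu z y -> ode_solution lambda gamma mu z y' ->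
  forall t, 0 <= t -> y' t = y t.
Proof.
move=> yS y'S t t0.
pose sq s := \sum_n (mass (y' s) n - mass (y s) n) ^+ 2.
pose dsq s :=
  2 * \sum_n (mass (y' s) n - mass (y s) n) * (V (y' s) n - V (y s) n).
have sqd s : 0 <= s -> deriv_within [set s | 0 <= s] sq s (dsq s).
  move=> s0; apply: (deriv_sqdist (f := fun s n => mass (y' s) n)
    (g := fun s n => mass (y s) n)) => n; first exact: ode_deriv y'S s0.
  exact: ode_deriv yS s0.
have : 0 <= -1 * (expR (- c * t) * sq t).
  pose w (_ : unit) s := -1 * (expR (- c * s) * sq s).
  apply: (@minimum_principle R unit [:: tt] (fun _ _ => 0) t w (fun _ s =>
    -1 * (- c * expR (- c * s) * sq s + expR (- c * s) * dsq s)) _ _ _ _ _ tt).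
  - exact: t0.
  - by [].
  - move=> i s _ /andP[s0 _]; apply: (@deriv_withinS _ [set s | 0 <= s]).
      by move=> r /=; rewrite in_itv /= => /andP[].
    by apply/deriv_withinZ/deriv_withinM; [exact: exp_deriv|exact: sqd].
  - move=> i s _ _; rewrite big_cons big_nil mul0r addr0 /=.
    have -> : -1 * (- c * expR (- c * s) * sq s + expR (- c * s) * dsq s) =
      expR (- c * s) * (c * sq s - dsq s) by ring.
    rewrite mulr_ge0 ?expR_ge0 // subr_ge0.
    apply: le_trans (one_sided_lipschitz _ _) _; rewrite sqnormB.
    by rewrite ler_wpM2r ?gerBl // sumr_ge0 // => n _; exact: sqr_ge0.
  - move=> i _; rewrite /w /sq (proj1 yS) (proj1 y'S) big1 ?mulr0 // => n _.
    by rewrite subrr expr0n.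
  - by [].
rewrite mulN1r oppr_ge0 pmulr_rle0 ?expR_gt0 // => sq0.
have sq_eq0 : sq t == 0.
  by rewrite eq_le sq0 sumr_ge0 // => n _; exact: sqr_ge0.
apply/val_inj/ffunP => n; move: sq_eq0.
rewrite psumr_eq0 => [/allP/(_ n (mem_index_enum _))|m _]; last exact: sqr_ge0.
by rewrite sqrf_eq0 subr_eq0 => /eqP.
Qed.

Lemma ode_solution_exists (z : simplex R X) :
  exists y, ode_solution lambda gamma mu z y.
Proof.
have [y [y0 yd]] := @ode_exists R X V c0
  (rate_bound_ge0 lambda_ge0 gamma_ge0 mu_ge0)
  (V_bound lambda_ge0 gamma_ge0 mu_ge0)
  (V_lipschitz lambda_ge0 gamma_ge0 mu_ge0)
  (V_ge lambda_ge0 gamma_ge0 mu_ge0) V_sum0 z.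
by exists y.
Qed.

(** [exp (- c t) (|x - y t|^2 + kappa / N)] is a nonnegative supermartingale
along the empirical process: the derivative of [y] and the drift of the process
combine into [V x - V (y t)], to which the one-sided Lipschitz bound applies. *)
Lemma empirical_maximal_inequality N (d : measure_display)
    (T : measurableType d) (P : probability T R)
    (Y : T -> cadlag (simplex R X)) (z : simplex R X)
    (y : cadlag (simplex R X)) (a : R) :
  (2 <= N)%N -> empirical_process lambda gamma mu N P Y ->
  ode_solution lambda gamma mu z y -> 0 < a ->
  exists B m, [/\ measurable B,
    ('E_P[(fun w => sqnorm (mass (Y w 0) - mass z))%R] = m%:E)%E,
    a * fine (P B) <= m + kappa / N%:R &
    forall w, ~ B w -> forall t, 0 <= t ->
      expR (- c * t) * sqnorm (mass (Y w t) - mass (y t)) <= a].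
Proof.
move=> N2 PY yS a0; set S : set (simplex R X) := empirical_states N.
have finS : finite_set S by exact: finite_empirical_states.
have N0 : 0 < N%:R :> R by rewrite ltr0n ltnW.
pose phi (t : R) (x : simplex R X) :=
  expR (- c * t) * (sqnorm (mass x - mass (y t)) + kappa / N%:R).
pose dphi (t : R) (x : simplex R X) :=
  - c * expR (- c * t) * (sqnorm (mass x - mass (y t)) + kappa / N%:R) +
  expR (- c * t) * (2 * \sum_n (x n - mass (y t) n) * (0 - V (y t) n)).
have kN0 : 0 <= kappa / N%:R by rewrite divr_ge0.
have phi0 t x : 0 <= t -> S x -> 0 <= phi t x.
  by move=> _ _; rewrite mulr_ge0 ?expR_ge0 // addr_ge0 // sqnorm_ge0.
have phid t x : 0 <= t -> S x ->
    deriv_within [set s | 0 <= s] (phi ^~ x) t (dphi t x).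
  move=> t0 _; apply: deriv_withinM; first exact: exp_deriv.
  rewrite -[2 * _]addr0; apply: deriv_withinD; last exact: deriv_within_cst.
  have -> : (fun s => sqnorm (mass x - mass (y s))) =
    (fun s => \sum_n (x n - mass (y s) n) ^+ 2).
    by apply/funext => s; exact: sqnormB.
  apply: (deriv_sqdist (f := fun _ n => x n)
    (g := fun s n => mass (y s) n)) => n;
    first exact: deriv_within_cst.
  exact: ode_deriv yS t0.
have gen t x : 0 <= t -> S x -> dphi t x + \sum_(u <- fset_set S)
    rate lambda gamma mu N x u * (phi t u - phi t x) <= 0.
  move=> t0 Sx; set e := expR (- c * t).
  have -> : \sum_(u <- fset_set S) rate lambda gamma mu N x u *
      (phi t u - phi t x) = e * \sum_(u <- fset_set S)
      rate lambda gamma mu N x u *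
      (sqnorm (mass u - mass (y t)) - sqnorm (mass x - mass (y t))).
    by rewrite mulr_sumr; apply: eq_bigr => u _; rewrite /phi -/e; ring.
  set L := \sum_(u <- _) _; have HL := generator_sqdist lambda_ge0 gamma_ge0
    mu_ge0 N2 (y t) Sx.
  have HV := one_sided_lipschitz x (y t).
  rewrite -/L -/kappa in HL; rewrite /dphi -/e.
  set s2 := sqnorm _ in HL HV *; set D := \sum_n _ * (0 - _).
  have s20 : 0 <= s2 by exact: sqnorm_ge0.
  have DE : \sum_n (x n - mass (y t) n) * (V x n - V (y t) n) =
      \sum_n (x n - mass (y t) n) * V x n + D.
    by rewrite /D -big_split; apply: eq_bigr => n _ /=; ring.
  have ck : 0 <= (c - 1) * (kappa / N%:R) by rewrite mulr_ge0 // subr_ge0.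
  rewrite DE in HV.
  have -> : - c * e * (s2 + kappa / N%:R) + e * (2 * D) + e * L =
    - (e * (c * s2 + c * (kappa / N%:R) - 2 * D - L)) by ring.
  by rewrite oppr_le0 mulr_ge0 ?expR_ge0 //; lra.
have [B [mB PB Bw]] := supermartingale_maximal_inequality finS PY
  (fun x u Sx _ => rate_ge0 lambda_ge0 gamma_ge0 mu_ge0 N2 u Sx)
  phi0 phid gen a0.
exists B, (mean_on S P Y setT 0 (fun x => sqnorm (mass x - mass z))).
split => //.
- exact: (expectation_mean_on (fun x => sqnorm (mass x - mass z)) finS PY).
- apply: le_trans PB _.
  have := mean_on1 finS PY measurableT (lexx 0).
  rewrite probability_setT /= => P1.
  have -> : kappa / N%:R = \sum_(x <- fset_set S)
      kappa / N%:R * fine (P (setT `&` [set w | Y w 0 = x])).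
    by rewrite -mulr_sumr P1 mulr1.
  rewrite -big_split /=.
  rewrite le_eqVlt; apply/orP; left; apply/eqP; apply: eq_bigr => x _.
  by rewrite /phi mulr0 expR0 mul1r (proj1 yS) mulrDl.
- move=> w nB t t0; apply: le_trans (Bw w nB t t0); rewrite /phi.
  by rewrite ler_wpM2l ?expR_ge0 // lerDl.
Qed.
(** Uniform closeness on [0, M] is closeness for the identity time change. *)
Lemma skorohod_ball_uniform (E : metricType R) (y x : cadlag E) (M e e' : R) :
  e' < e -> 0 <= e' -> (forall t, 0 <= t <= M -> mdist (y t) (x t) <= e') ->
  skorohod_ball y M e x.
Proof.
move=> e'e e'0 yx; exists id; split.
  by split; [split=> // t t0; exists t|move=> s t _ _].
by exists e' => //; split=> [t t0|//]; rewrite subrr normr0.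
Qed.

Lemma uniformly_close (x y : cadlag (simplex R X)) (M e : R) :
  0 < e -> 0 <= M ->
  (forall t, 0 <= t -> expR (- c * t) * sqnorm (mass (x t) - mass (y t)) <=
    e ^+ 2 / ((#|{: X}|%:R + 1) * expR (c * M))) ->
  forall t, 0 <= t <= M -> mdist (y t) (x t) <= e.
Proof.
move=> e0 M0 close t /andP[t0 tM].
rewrite -[mdist _ _]/(simplex_dist (y t) (x t)).
have -> : simplex_dist (y t) (x t) = simplex_dist (x t) (y t).
  by apply: eq_bigr => n _; rewrite distrC.
have X1 : 0 < #|{: X}|%:R + 1 :> R by rewrite ltr_wpDl.
have expM : 0 < expR (c * M) by exact: expR_gt0.
have sq_le : (#|{: X}|%:R + 1) * sqnorm (mass (x t) - mass (y t)) <= e ^+ 2.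
  have := close t t0; rewrite ler_pdivlMr ?mulr_gt0 //; apply: le_trans.
  have -> : expR (- c * t) * sqnorm (mass (x t) - mass (y t)) *
      ((#|{: X}|%:R + 1) * expR (c * M)) = expR (- c * t) * expR (c * M) *
      ((#|{: X}|%:R + 1) * sqnorm (mass (x t) - mass (y t))) by ring.
  rewrite ler_peMl ?mulr_ge0 ?sqnorm_ge0 ?(ltW X1) //.
  rewrite -expRD -expR0 ler_expR mulNr addrC subr_ge0 ler_wpM2l //.
  exact: le_trans ler01 c_ge1.
rewrite -(ler_pXn2r (n := 2)) ?nnegrE ?simplex_dist_ge0 ?(ltW e0) //.
apply: le_trans (simplex_dist_sqnorm _ _) _; apply: le_trans sq_le.
by rewrite ler_wpM2r ?sqnorm_ge0 // lerDl.
Qed.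

Lemma sqnorm_continuous (z : simplex R X) :
  continuous (fun x : simplex R X => sqnorm (mass x - mass z)).
Proof.
move=> x U /nbhs_ballP[e /= e0 eU]; apply/nbhs_ballP.
exists (e / 2); first exact: divr_gt0.
move=> x'; rewrite ballEmdist /= => xx'; apply: eU; rewrite /ball /=.
by apply: le_lt_trans (sqnorm_lipschitz _ _ _) _; rewrite mulrC -ltr_pdivlMr.
Qed.

(** The square distance to [z] is a continuous bounded function that vanishes at
[z], so that the convergence of the initial states makes its expectation tend
to 0; this is all that the maximal inequality asks of them. *)
Lemma mean_field_convergence (d : nat -> measure_display)
    (T : forall N, measurableType (d N)) (P : forall N, probability (T N) R)
    (Y : forall N, T N -> cadlag (simplex R X)) (z : simplex R X)
    (y : cadlag (simplex R X)) :
  (forall N, (2 <= N)%N -> empirical_process lambda gamma mu N (P N) (Y N)) ->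
  cvg_in_distribution P (fun N w => Y N w 0) z ->
  ode_solution lambda gamma mu z y -> cvg_in_distribution P Y y.
Proof.
move=> hY hz yS f fc [M fM].
have M0 : 0 <= M by apply: le_trans (fM y); exact: normr_ge0.
suff key (eta : R) : 0 < eta -> \forall N \near \oo,
    ((f y - eta)%:E <= 'E_(P N)[f \o Y N] <= (f y + eta)%:E)%E.
  have fin N r r' : (r%:E <= 'E_(P N)[f \o Y N] <= r'%:E)%E ->
      ('E_(P N)[f \o Y N])%E \is a fin_num.
    move=> /andP[l u].
    by rewrite fin_numElt (lt_le_trans (ltNyr _) l) (le_lt_trans u (ltry _)).
  apply/fine_cvgP; split.
    by apply: filterS (key 1 ltr01) => N; exact: fin.
  apply/cvgrPdist_le => eta /key; apply: filterS => N lu.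
  move: (lu); rewrite -(fineK (fin _ _ _ lu)) !lee_fin => /andP[l u].
  by rewrite /= ler_norml; lra.
move=> eta0.
have eta2 : 0 < eta / 2 by rewrite divr_gt0.
have : \forall x \near y, `|f y - f x| <= eta / 2.
  by move: (fc y) => /cvgrPdist_le; exact.
move=> /skorohod_nbhsP[M1 [e [M10 e0 ball_sub]]].
have e2 : 0 < e / 2 by rewrite divr_gt0.
set a := (e / 2) ^+ 2 / ((#|{: X}|%:R + 1) * expR (c * M1)).
have a0 : 0 < a.
  by rewrite divr_gt0 ?exprn_gt0 // mulr_gt0 ?expR_gt0 // ltr_wpDl.
(* [delta] bounds the initial mean and [kappa / N]; then [B] has probability at
   most [2 delta / a] and contributes at most [eta / 2]. *)
pose delta := a * eta / (8 * (M + 1)).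
have M1_gt0 : 0 < M + 1 by rewrite ltr_wpDl.
have delta0 : 0 < delta by apply: divr_gt0; apply: mulr_gt0.
have initial : \forall N \near \oo, fine ('E_(P N)[
    (fun w => sqnorm (mass (Y N w 0) - mass z))%R])%E <= delta.
  have bounded_sq : exists b : R, forall x : simplex R X,
      `|sqnorm (mass x - mass z)| <= b.
    by exists 2 => x; rewrite ger0_norm ?sqnorm_ge0 // sqnorm_le2.
  have := hz _ (@sqnorm_continuous z) bounded_sq.
  rewrite sqnorm_xx => /fine_cvgP[_ /cvgr_le]; exact.
have large : \forall N \near \oo, kappa / delta <= N%:R.
  exact: nbhs_infty_ger.
have two : \forall N \near \oo, (2 <= N)%N by exact: nbhs_infty_ge.
near=> N; have N2 : (2 <= N)%N by near: N.
have [B [m [mB mE PB Bw]]] := empirical_maximal_inequality N2 (hY N N2) yS a0.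
have m_le : m <= delta.
  have : fine ('E_(P N)[
      (fun w => sqnorm (mass (Y N w 0) - mass z))%R])%E <= delta.
    by near: N.
  by rewrite mE.
have k_le : kappa / N%:R <= delta.
  rewrite ler_pdivrMr ?ltr0n 1?ltnW // mulrC -ler_pdivrMr //; by near: N.
have PB_le : 2 * M * fine (P N B) <= eta / 2.
  have pB : 0 <= fine (P N B) by exact/fine_ge0/measure_ge0.
  have H : a * fine (P N B) <= a * (eta / (4 * (M + 1))).
    apply: le_trans PB _.
    have -> : a * (eta / (4 * (M + 1))) = delta + delta.
      by rewrite /delta; field; rewrite gt_eqF.
    exact: lerD.
  rewrite ler_pM2l // in H.
  apply: le_trans (_ : 2 * (M + 1) * fine (P N B) <= _).
    by rewrite ler_wpM2r // ler_wpM2l // lerDl.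
  apply: le_trans (ler_wpM2l _ H) _; first by rewrite mulr_ge0 // ltW.
  by rewrite le_eqVlt; apply/orP; left; apply/eqP; field; rewrite gt_eqF.
have FM w : `|(f \o Y N) w - f y| <= 2 * M.
  apply: le_trans (ler_normB _ _) _; rewrite mulr_natl mulr2n.
  by apply: lerD; exact: fM.
have Fe w : ~ B w -> `|(f \o Y N) w - f y| <= eta / 2.
  move=> nB; rewrite distrC; apply: ball_sub.
  apply: (@skorohod_ball_uniform _ y (Y N w) M1 e (e / 2)) (ltW e2) _.
    by rewrite ltr_pdivrMr // ltr_pMr // ltr1n.
  by apply: uniformly_close e2 (ltW M10) _; exact: Bw.
have /andP[l u] := expectation_close (P N) mB FM Fe (ltW eta2).
apply/andP; split.
  by apply: le_trans l; rewrite lee_fin; lra.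
by apply: le_trans u _; rewrite lee_fin; lra.
Unshelve. all: by end_near. Qed.
End mean_field_limit.

Theorem theorem1 (R : realType) (K C : nat) (A : 'I_K -> nat)
    (lambda gamma mu : 'I_K -> R)
    (hK : (0 < K)%N) (hC : (0 < C)%N) (hA : forall k, (0 < A k)%N)
    (hlambda : forall k, 0 < lambda k) (hgamma : forall k, 0 < gamma k)
    (hmu : forall k, 0 <= mu k)
    (d : nat -> measure_display) (T : forall N, measurableType (d N))
    (P : forall N, probability (T N) R)
    (Y : forall N, T N -> cadlag (simplex R (config C A)))
    (hY : forall N, (2 <= N)%N ->
       empirical_process lambda gamma mu N (P N) (Y N))
    (z : simplex R (config C A))
    (hz : cvg_in_distribution P (fun N w => Y N w 0) z) :
  exists y : cadlag (simplex R (config C A)),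
    [/\ ode_solution lambda gamma mu z y,
        forall y' : cadlag (simplex R (config C A)),
          ode_solution lambda gamma mu z y' ->
          forall t, 0 <= t -> y' t = y t &
        cvg_in_distribution P Y y].
Proof.
have lambda_ge0 k : 0 <= lambda k by exact: ltW.
have gamma_ge0 k : 0 <= gamma k by exact: ltW.
have [y yS] := ode_solution_exists lambda_ge0 gamma_ge0 hmu z.
exists y; split => //.
  by move=> y'; exact: ode_unique yS.
exact: mean_field_convergence hY hz yS.
Qed.
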